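(* Let $(M,\mathscr{F})$ be a differential space which is diffeomorphic to a subset of $\mathbb{R}^n$ (equipped with the subspace differential structure induced from $C^\infty(\mathbb{R}^n)$) for some $n$, and let $v\colon \mathscr{F}\to\mathscr{F}$ be a derivation. Then $v$ has a unique flow (in particular, the flow is a smooth map of differential spaces).
   Context: **Differential spaces.** A differential space (in the sense of Sikorski) is a pair $(M,\mathscr{F})$, where $M$ is a topological space and $\mathscr{F}$ is a nonempty set of real-valued functions on $M$ (the differential structure) such that: (1) the topology of $M$ is the smallest topology making every function in $\mathscr{F}$ continuous; (2) for every integer $m\ge 0$, every $g\in C^\infty(\mathbb{R}^m)$ and all $f_1,\dots,f_m\in\mathscr{F}$, the composite $g\circ(f_1,\dots,f_m)$ is in $\mathscr{F}$; (3) if $g\colon M\to\mathbb{R}$ is a function such that every $p\in M$ has a neighborhood $U$ and a function $a\in\mathscr{F}$ with $g|_U=a|_U$, then $g\in\mathscr{F}$. A manifold (smooth, Hausdorff, second countable) $N$ is regarded as a differential space with $\mathscr{F}=C^\infty(N)$. A map $\varphi\colon (M,\mathscr{F}_M)\to(N,\mathscr{F}_N)$ of differential spaces is smooth if $f\circ\varphi\in\mathscr{F}_M$ for all $f\in\mathscr{F}_N$. It is a diffeomorphism if it is smooth and invertible with smooth inverse. The differential structure $\langle A\rangle$ generated by a set $A$ of real-valued functions on a set is the smallest differential structure containing $A$ (with the corresponding initial topology). For a subset $N\subseteq M$ of a differential space $(M,\mathscr{F})$, the subspace (induced) differential structure on $N$ is $\langle \mathscr{F}|_N\rangle$, where $\mathscr{F}|_N=\{f|_N: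 f\in\mathscr{F}\}$. The product $M_1\times M_2$ of differential spaces $(M_i,\mathscr{F}_i)$ carries the product differential structure $\langle \pi_1^*\mathscr{F}_1\cup\pi_2^*\mathscr{F}_2\rangle$, where $\pi_i$ are the projections. **Derivations.** A derivation of $\mathscr{F}$ is an $\mathbb{R}$-linear map $v\colon\mathscr{F}\to\mathscr{F}$ with $v(fg)=v(f)g+fv(g)$ for all $f,g\in\mathscr{F}$. For differential structures this is the same as a $C^\infty$-ring derivation, i.e. a map with $v(g\circ(f_1,\dots,f_n))=\sum_i ((\partial_i g)\circ(f_1,\dots,f_n))\,v(f_i)$ for all $n\ge 1$, $g\in C^\infty(\mathbb{R}^n)$, $f_i\in\mathscr{F}$; the two notions are not distinguished. **Integral curves.** An interval is a connected subset of $\mathbb{R}$ (a single point is allowed; intervals need not be open), with the induced differential structure, the smooth functions $C^\infty(J)$. An integral curve of $v$ is either a map $\gamma\colon J\to M$ from a one-point interval, or a smooth map $\gamma\colon (J,C^\infty(J))\to(M,\mathscr{F})$ from an interval $J$ such that $\frac{d}{dx}(f\circ\gamma)=v(f)\circ\gamma$ for all $f\in\mathscr{F}$. All integral curves are assumed to have $0$ in their domain. An integral curve $\gamma\colon I\to M$ of $v$ is maximal if for every integral curve $\tau\colon K\to M$ of $v$ with $\tau(0)=\gamma(0)$ one has $K\subseteq I$ and $\gamma|_K=\tau$. **Flows.** A flow of $v$ is a smooth map $\Phi\colon W\to M$ from a subspace $W$ of $M\times\mathbb{R}$ (with the subspace differential structure induced from the product differential structure) with $M\times\{0\}\subset W$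 such that for all $x\in M$: (1) $\Phi(x,0)=x$; (2) the set $I_x:=\{t\in\mathbb{R}:(x,t)\in W\}$ is connected; (3) the map $\Phi(x,\cdot)\colon I_x\to M$ is a maximal integral curve of $v$. *)

(* Defs.v *)
From HB Require Import structures.
From mathcomp Require Import all_boot all_order all_algebra.
From mathcomp Require Import all_classical all_reals all_analysis.

Set Implicit Arguments.
Unset Strict Implicit.
Unset Printing Implicit Defensive.

Import Order.TTheory GRing.Theory Num.Theory.
Import numFieldNormedType.Exports.

Local Open Scope classical_set_scope.
Local Open Scope ring_scope.

(* C^k on R^m: continuous, and for k > 0 the partial derivatives exist
   everywhere and are C^(k-1). *)
Fixpoint Ck (R : realType) (m k : nat) (g : 'rV[R]_m -> R) : Prop :=
  continuous g /\
  if k is k'.+1 then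
    forall i : 'I_m,
      (forall x, derivable g x (delta_mx 0 i)) /\
      Ck k' (fun x => 'D_(delta_mx 0 i) g x)
  else True.

Definition Cinf (R : realType) (m : nat) : set ('rV[R]_m -> R) :=
  [set g | forall k, Ck k g].

Definition Cinf_line (R : realType) : set (R -> R) :=
  [set g | forall k x, derivable (derive1n k g) x 1].

Definition is_topology (T : Type) (O : set (set T)) : Prop :=
  [/\ O setT,
      forall A B, O A -> O B -> O (A `&` B) &
      forall C : set (set T), C `<=` O -> O (\bigcup_(A in C) A)].

(* Open sets of the smallest topology making every function in F continuous. *)
Definition initial_open (R : realType) (T : Type) (F : set (T -> R)) :
    set (set T) :=
  [set U | forall O : set (set T), is_topology O ->
    (forall f (V : set R), F f -> open V -> O (f @^-1` V)) -> O U].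

(* The topology is determined by F, so a differential structure makes sense on
   a bare type; [diff_space] compares it with a given topology. *)
Record diff_structure (R : realType) (T : Type) (F : set (T -> R)) : Prop := {
  ds_nonempty : F !=set0;
  ds_comp : forall (m : nat) (g : 'rV[R]_m -> R) (f : 'I_m -> T -> R),
    Cinf g -> (forall i, F (f i)) -> F (fun p => g (\row_i f i p));
  ds_local : forall g : T -> R,
    (forall p, exists U a,
      [/\ initial_open F U, U p, F a & forall q, U q -> g q = a q]) -> F g }.

Definition diff_space (R : realType) (M : topologicalType) (F : set (M -> R)) :
    Prop :=
  diff_structure F /\ forall U : set M, open U <-> initial_open F U.

(* The intersection of all differential structures containing A, which is
   itself one. *)
Definition generated (R : realType) (T : Type) (A : set (T -> R)) :
    set (T -> R) :=
  [set f | forall F, diff_structure F -> A `<=` F -> F f].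

Definition subspace_structure (R : realType) (T : Type) (F : set (T -> R))
    (S : set T) : set (S -> R) :=
  generated [set (fun x : S => f (val x)) | f in F].

Definition product_structure (R : realType) (T1 T2 : Type)
    (F1 : set (T1 -> R)) (F2 : set (T2 -> R)) : set (T1 * T2 -> R) :=
  generated ([set f \o fst | f in F1] `|` [set f \o snd | f in F2]).

Definition smooth_map (R : realType) (T1 T2 : Type)
    (F1 : set (T1 -> R)) (F2 : set (T2 -> R)) (phi : T1 -> T2) : Prop :=
  forall f, F2 f -> F1 (f \o phi).

Definition diffeomorphic (R : realType) (T1 T2 : Type)
    (F1 : set (T1 -> R)) (F2 : set (T2 -> R)) : Prop :=
  exists (phi : T1 -> T2) (psi : T2 -> T1),
    [/\ cancel phi psi, cancel psi phi,
        smooth_map F1 F2 phi & smooth_map F2 F1 psi].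

(* A map F -> F is represented by a map on all functions that preserves F; its
   values outside F are irrelevant. *)
Record derivation (R : realType) (T : Type) (F : set (T -> R))
    (v : (T -> R) -> (T -> R)) : Prop := {
  der_stable : forall f, F f -> F (v f);
  der_add : forall f g, F f -> F g ->
    v (fun p => f p + g p) = (fun p => v f p + v g p);
  der_scale : forall (a : R) f, F f ->
    v (fun p => a * f p) = (fun p => a * v f p);
  der_mul : forall f g, F f -> F g ->
    v (fun p => f p * g p) = (fun p => v f p * g p + f p * v g p) }.

(* Partial maps (integral curves and flows) are pairs of a domain and a total
   map, whose values outside the domain are irrelevant. *)
Definition smooth_on (R : realType) (T1 T2 : Type)
    (F1 : set (T1 -> R)) (F2 : set (T2 -> R)) (D : set T1) (phi : T1 -> T2) :
    Prop :=
  smooth_map (subspace_structure F1 (S := D)) F2 (fun x : D => phi (val x)).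

(* The derivative relative to the interval J is one-sided at the endpoints
   belonging to J. *)
Definition has_derivative_within (R : realType) (J : set R) (h : R -> R)
    (t l : R) : Prop :=
  (fun s => (h s - h t) / (s - t)) @ within J t^' --> l.

Definition integral_curve (R : realType) (T : Type) (F : set (T -> R))
    (v : (T -> R) -> (T -> R)) (J : set R) (c : R -> T) : Prop :=
  [/\ connected J, J 0 &
      (exists t, J = [set t]) \/
      (smooth_on (@Cinf_line R) F J c /\
       forall f, F f -> forall t, J t ->
         has_derivative_within J (f \o c) t (v f (c t)))].

Definition maximal_integral_curve (R : realType) (T : Type) (F : set (T -> R))
    (v : (T -> R) -> (T -> R)) (I : set R) (c : R -> T) : Prop :=
  integral_curve F v I c /\
  forall (K : set R) (tau : R -> T),
    integral_curve F v K tau -> tau 0 = c 0 ->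
    K `<=` I /\ forall t, K t -> c t = tau t.

Record flow (R : realType) (T : Type) (F : set (T -> R))
    (v : (T -> R) -> (T -> R)) (W : set (T * R)) (Phi : T * R -> T) : Prop := {
  flow_smooth : smooth_on (product_structure F (@Cinf_line R)) F W Phi;
  flow_dom0 : forall x, W (x, 0);
  flow_init : forall x, Phi (x, 0) = x;
  flow_connected : forall x, connected [set t : R | W (x, t)];
  flow_maximal : forall x,
    maximal_integral_curve F v [set t | W (x, t)] (fun t => Phi (x, t)) }.

(* Main.v *)
Require Import Defs.
From mathcomp Require Import all_boot all_order all_algebra.
From mathcomp Require Import all_classical all_reals all_analysis.
From mathcomp Require Import ring lra.

Set Implicit Arguments.
Unset Strict Implicit.
Unset Printing Implicit Defensive.

Import Order.TTheory GRing.Theory Num.Theory.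
Import numFieldNormedType.Exports.

Local Open Scope classical_set_scope.
Local Open Scope ring_scope.

(* In coordinates X on M, the derivation is locally the restriction of a smooth
   vector field A on R^n, so integral curves solve z' = A(z).  The time-tau map of
   A is the time-1 map of tau * A on R^(n+1), tau being a constant coordinate; so
   all that is needed from the theory of differential equations is that the
   time-1 map of a smooth field depends smoothly on the initial point.  This is
   proved for all dimensions at once by induction on k: the map is C^0 by
   Gronwall's inequality, and its partial derivatives are components of the
   time-1 map of the variational field, hence C^k by induction.
   Near every point, integral curves are therefore given by one smooth map, the
   flow box, as long as they exist.  Two integral curves with the same origin
   agree by real induction in time along flow boxes, so their union is the maximal
   one, and the union flow is smooth because composing flow boxes along an
   integral curve extends it to a smooth map near any of its points. *)

(** * Smooth functions on R^m *)

Section RowVectors.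
Context {R : realType}.

(** The image of M in R^n is an arbitrary subset: a trajectory of the field A that starts in M may
    leave M at once, and the domain of the flow need not be open. So existence of solutions is used
    in R^n only. On M the curve defined at time 0 alone is always there, and the domain of the
    maximal curve is the union of the domains of whatever integral curves exist. For the same reason
    smoothness takes the form of an extension: near each point of its domain, the flow agrees,
    wherever it is defined, with a smooth map on R^(n+1). This is what the structure induced on the
    domain asks for. The components of A are functions a_i with v(X_i) = a_i o X near one point.
    Away from it nothing is known, so the field is truncated, and a continuity argument shows that
    short curves stay where the truncation changes nothing. Integral curves may have end points with
    one-sided derivatives, and times may be negative. Every piece of curve is therefore rescaled to
    [0, 1] and continued as a constant; the differential equation is only ever used inside (0,
    1). *)

Lemma norm_coord_le m (x : 'rV[R]_m) i : `|x 0 i| <= `|x|.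
Proof.
rewrite [leRHS]/Num.Def.normr/= mx_normrE.
exact: (le_bigmax _ (fun ij : 'I_1 * 'I_m => `|x ij.1 ij.2|) (0, i)).
Qed.

Lemma rV_norm_le m (x : 'rV[R]_m) (C : R) :
  0 <= C -> (forall i, `|x 0 i| <= C) -> `|x| <= C.
Proof.
move=> C0 xC; rewrite [leLHS]/Num.Def.normr/= mx_normrE bigmax_le// => -[j i] _ /=.
by rewrite (ord1 j).
Qed.

Lemma cvg_rV (T : Type) (F : set_system T) {FF : Filter F} m
    (f : T -> 'rV[R]_m) (l : 'rV[R]_m) :
  (forall i, f t 0 i @[t --> F] --> l 0 i) -> f t @[t --> F] --> l.
Proof.
move=> fl; apply/cvgrPdist_le => /= e e0; near=> t.
apply: rV_norm_le => [|i]; first exact: ltW.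
rewrite !mxE; move: i; near: t; apply: filter_forall => i.
by move: e0; apply: (cvgrPdist_le _ _).1; exact: fl.
Unshelve. all: by end_near. Qed.

Lemma cvg_coord (T : Type) (F : set_system T) {FF : Filter F} m
    (f : T -> 'rV[R]_m) (l : 'rV[R]_m) i :
  f t @[t --> F] --> l -> f t 0 i @[t --> F] --> l 0 i.
Proof. by move=> fl; apply: (continuous_cvg _ (@coord_continuous R 1 m 0 i l)). Qed.

Lemma continuous_rV (T : topologicalType) m (f : T -> 'rV[R]_m) :
  (forall i, continuous (fun t => f t 0 i)) -> continuous f.
Proof. by move=> cf t; apply: cvg_rV => i; exact: cf. Qed.

(** Turns a derivative along a vector into one on the line, where the mean value theorem and the
    one-variable chain rule apply. *)
Lemma is_derive_line (V : normedModType R) (f : V -> R) (x v : V) (d : R) :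
  is_derive x v f d <-> is_derive (0 : R) 1 (fun s : R => f (x + s *: v)) d.
Proof.
have E : (fun h : R => h^-1 *: (f (h *: v + x) - f x)) =
   (fun h : R => h^-1 *: (f (x + (h *: (1 : R) + 0) *: v) - f (x + 0 *: v))).
  by apply: funext => h; rewrite scale0r !addr0 [h *: 1]mulr1 [x + _]addrC.
split=> -[df <-]; split.
- by rewrite /derivable /= -E.
- by rewrite /derive /= -E.
- by rewrite /derivable /= E.
- by rewrite /derive /= E.
Qed.

Lemma is_derive_along (V : normedModType R) (f : V -> R) (x v : V) (s : R) :
  derivable f (x + s *: v) v ->
  is_derive s 1 (fun s : R => f (x + s *: v)) ('D_v f (x + s *: v)).
Proof.
move=> /derivableP/is_derive_line df.
have -> : (fun s0 : R => f (x + s0 *: v)) =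
  (fun s0 => f (x + s *: v + s0 *: v)) \o (fun u => u - s).
  by apply/funext => u /=; congr f; rewrite -addrA -scalerDl addrCA subrr addr0.
rewrite -[X in is_derive _ _ _ X]mulr1.
apply: is_derive1_comp; first by rewrite subrr.
by apply: is_derive_eq; rewrite subr0.
Qed.

(** The corners of the staircase path from [0] to [w] with edges parallel to the axes. *)
Definition trunc_rV m (w : 'rV[R]_m) (k : nat) : 'rV[R]_m :=
  \row_i (if (i < k)%N then w 0 i else 0).

Lemma trunc_rV0 m (w : 'rV[R]_m) : trunc_rV w 0 = 0.
Proof. by apply/rowP => i; rewrite !mxE. Qed.

Lemma trunc_rV_all m (w : 'rV[R]_m) : trunc_rV w m = w.
Proof. by apply/rowP => i; rewrite !mxE ltn_ord. Qed.

Lemma trunc_rVS m (w : 'rV[R]_m) (i : 'I_m) :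
  trunc_rV w i.+1 = trunc_rV w i + w 0 i *: delta_mx 0 i.
Proof.
apply/rowP => j; rewrite !mxE eqxx /= ltnS leq_eqVlt.
have [<-|ij] := eqVneq i j; first by rewrite eqxx ltnn /= mulr1 add0r.
have /negPf -> : nat_of_ord j != i by rewrite eq_sym.
by rewrite /= mulr0 addr0.
Qed.

Lemma mvt_line (f df : R -> R) (w : R) :
  (forall s : R, is_derive s 1 f (df s)) ->
  exists2 c, `|c| <= `|w| & f w - f 0 = df c * w.
Proof.
move=> fdf.
have cf (A : set R) : {within A, continuous f}.
  by apply: continuous_subspaceT => s; apply/differentiable_continuous/derivable1_diffP.
have [w0|w0] := leP 0 w.
  have [c + E] := MVT_segment w0 (fun s _ => fdf s) (cf _).
  rewrite in_itv /= subr0 in E * => /andP[c0 cw]; exists c => //.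
  by rewrite !ger0_norm.
have [c + E] := MVT_segment (ltW w0) (fun s _ => fdf s) (cf _).
rewrite in_itv /= => /andP[wc c0]; exists c.
  by rewrite !ler0_norm ?lerN2 // ltW.
by rewrite -opprB E sub0r mulrN opprK.
Qed.

(* Go from [y] to [y'] along the coordinate directions, one at a time. *)
Lemma coordinate_mvt m (g : 'rV[R]_m -> R) (y y' : 'rV[R]_m) :
  (forall i x, derivable g x (delta_mx 0 i)) ->
  exists xi : 'I_m -> 'rV[R]_m,
    (forall i, `|xi i - y| <= `|y' - y|) /\
    g y' - g y = \sum_i 'D_(delta_mx 0 i) g (xi i) * (y' 0 i - y 0 i).
Proof.
move=> dg; set w := y' - y.
have step (i : 'I_m) : exists z : 'rV[R]_m, `|z - y| <= `|w| /\
    g (y + trunc_rV w i.+1) - g (y + trunc_rV w i) =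
    'D_(delta_mx 0 i) g z * w 0 i.
  pose x := y + trunc_rV w i.
  have [c cw E] := @mvt_line (fun s => g (x + s *: delta_mx 0 i))
    (fun s => 'D_(delta_mx 0 i) g (x + s *: delta_mx 0 i)) (w 0 i)
    (fun s => is_derive_along (dg i _)).
  exists (x + c *: delta_mx 0 i); split.
    apply: rV_norm_le => // j.
    have -> : (x + c *: delta_mx 0 i - y) 0 j =
        (if (j < i)%N then w 0 j else 0) + c * (j == i)%:R.
      by rewrite /x !mxE eqxx /=; case: ifP => _; ring.
    have [->|ji] := eqVneq j i.
      by rewrite ltnn add0r mulr1 (le_trans cw)// norm_coord_le.
    rewrite mulr0 addr0; case: ifP => _; first exact: norm_coord_le.
    by rewrite normr0.
  by rewrite -E /= scale0r addr0 trunc_rVS addrA.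
have [xi xiP] := choice step; exists xi; split=> [i|]; first by case: (xiP i).
have -> : g y' - g y = g (y + trunc_rV w m) - g (y + trunc_rV w 0).
  by rewrite trunc_rV0 addr0 trunc_rV_all /w [y + _]addrC subrK.
rewrite -(telescope_sumr (fun k => g (y + trunc_rV w k)) (leq0n m)).
rewrite big_mkord; apply: eq_bigr => i _.
by rewrite (xiP i).2 /w !mxE.
Qed.

Lemma cvg_sum_ord (T : Type) (F : set_system T) {FF : Filter F} m
    (f : 'I_m -> T -> R) (l : 'I_m -> R) :
  (forall i, f i t @[t --> F] --> l i) ->
  \sum_i f i t @[t --> F] --> \sum_i l i.
Proof. by move=> fl; apply: cvg_big => //; exact: add_continuous. Qed.

(** [coordinate_mvt] writes [g (c s) - g (c t)] as a sum of partial derivatives times increments of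
    the coordinates of [c]. Inserting Caratheodory slopes of these coordinates gives such a slope
    for the composite. It is continuous at [t] because the intermediate points are squeezed towards
    [c t]. *)
Lemma is_derive_chain m (g : 'rV[R]_m -> R) (c : R -> 'rV[R]_m) (t : R)
    (d : 'I_m -> R) :
  (forall i x, derivable g x (delta_mx 0 i)) ->
  (forall i, continuous (fun x => 'D_(delta_mx 0 i) g x)) ->
  (forall i, is_derive t 1 (fun s => c s 0 i) (d i)) ->
  is_derive t 1 (fun s => g (c s)) (\sum_i 'D_(delta_mx 0 i) g (c t) * d i).
Proof.
move=> dg cg dc.
have ct : {for t, continuous c}.
  apply: cvg_rV => i.
  by have [/derivable1_diffP/differentiable_continuous] := dc i.
have [k kP] := choice (fun i => (is_derive1_caratheodory _ _ _).1 (dc i)).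
have [xi xiP] := choice (fun s => coordinate_mvt (c t) (c s) dg).
apply/is_derive1_caratheodory.
exists (fun s => \sum_i 'D_(delta_mx 0 i) g (xi s i) * k i s); split.
- move=> s; rewrite (xiP s).2 mulr_suml; apply: eq_bigr => i _.
  by have [-> _ _] := kP i; rewrite mulrA.
- have xit i : xi t i = c t.
    apply/eqP; rewrite -subr_eq0 -normr_le0.
    by have := (xiP t).1 i; rewrite subrr normr0.
  apply: cvg_sum_ord => i; apply: cvgM; last by have [_ + _] := kP i.
  rewrite xit; apply: (@cvg_comp _ _ _ (fun s => xi s i) (fun x => 'D_(delta_mx 0 i) g x) _
    (nbhs (c t))); last exact: cg.
  apply/cvgrPdist_le => e e0; move/cvgrPdist_le : ct => /(_ e e0).
  apply: filterS => s; rewrite distrC [X in _ -> X <= _]distrC.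
  by apply: le_trans; exact: (xiP s).1.
- apply: eq_bigr => i _; have [_ _ ->] := kP i; congr ('D_ _ g _ * _).
  apply/eqP; rewrite -subr_eq0 -normr_le0.
  by have := (xiP t).1 i; rewrite subrr normr0.
Qed.

End RowVectors.

(** * Closure properties of C^k and smooth functions *)

Section SmoothCalculus.
Context {R : realType}.

Lemma Ck_continuous m k (g : 'rV[R]_m -> R) : Ck k g -> continuous g.
Proof. by case: k => [|k] []. Qed.

Lemma CkS m k (g : 'rV[R]_m -> R) : Ck k.+1 g -> Ck k g.
Proof.
elim: k g => [g [cg _]|k IH g [cg dg]]; first by split.
by split=> // i; have [dgi /IH] := dg i.
Qed.

Lemma Ck_build m k (g : 'rV[R]_m -> R) (dg : 'I_m -> 'rV[R]_m -> R) :
  continuous g -> (forall i x, is_derive x (delta_mx 0 i) g (dg i x)) ->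
  (forall i, Ck k (dg i)) -> Ck k.+1 g.
Proof.
move=> cg dgP Ckdg; split=> // i; split=> [x|]; first by have [] := dgP i x.
suff -> : (fun x => 'D_(delta_mx 0 i) g x) = dg i by [].
by apply/funext => x; have [_] := dgP i x.
Qed.

Lemma Ck_partial m k (g : 'rV[R]_m -> R) i :
  Ck k.+1 g -> (forall x, is_derive x (delta_mx 0 i) g ('D_(delta_mx 0 i) g x)) /\
    Ck k (fun x => 'D_(delta_mx 0 i) g x).
Proof. by move=> [_ /(_ i)[dg Cg]]; split=> // x; exact/derivableP. Qed.

Lemma Ck_cst m k (a : R) : Ck k (fun _ : 'rV[R]_m => a).
Proof.
elim: k a => [a|k IH a]; first by split=> //; exact: cst_continuous.
by apply: (@Ck_build _ _ _ (fun _ _ => 0)) => //; exact: cst_continuous.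
Qed.

Lemma Ck_coord m k i : Ck k (fun x : 'rV[R]_m => x 0 i).
Proof.
case: k => [|k]; first by split=> //; exact: coord_continuous.
apply: (@Ck_build _ _ _ (fun j _ => (i == j)%:R)).
- exact: coord_continuous.
- move=> j x; apply/is_derive_line.
  have -> : (fun s : R => (x + s *: delta_mx 0 j) 0 i) =
      (fun s : R => x 0 i + s * (i == j)%:R).
    by apply: funext => s; rewrite !mxE eqxx.
  by apply: is_derive_eq; rewrite scaler0 !add0r [(_%:R)%:A]mulr1 [LHS]mul1r.
- by move=> j; exact: Ck_cst.
Qed.

Lemma Ck_add m k (f g : 'rV[R]_m -> R) :
  Ck k f -> Ck k g -> Ck k (fun x => f x + g x).
Proof.
elim: k f g => [f g [cf _] [cg _]|k IH f g Cf Cg].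
  by split=> // x; exact: (cvgD (cf x) (cg x)).
apply: (@Ck_build _ _ _
  (fun i x => 'D_(delta_mx 0 i) f x + 'D_(delta_mx 0 i) g x)).
- by move=> x; exact: (cvgD (Ck_continuous Cf (x:=x)) (Ck_continuous Cg (x:=x))).
- move=> i x; apply: is_deriveD; [exact: (Ck_partial i Cf).1|exact: (Ck_partial i Cg).1].
- by move=> i; apply: IH; [exact: (Ck_partial i Cf).2|exact: (Ck_partial i Cg).2].
Qed.

Lemma Ck_mul m k (f g : 'rV[R]_m -> R) :
  Ck k f -> Ck k g -> Ck k (fun x => f x * g x).
Proof.
elim: k f g => [f g [cf _] [cg _]|k IH f g Cf Cg].
  by split=> // x; exact: (cvgM (cf x) (cg x)).
apply: (@Ck_build _ _ _
  (fun i x => f x * 'D_(delta_mx 0 i) g x + g x * 'D_(delta_mx 0 i) f x)).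
- by move=> x; exact: (cvgM (Ck_continuous Cf (x:=x)) (Ck_continuous Cg (x:=x))).
- move=> i x; apply: is_deriveM; [exact: (Ck_partial i Cf).1|exact: (Ck_partial i Cg).1].
- move=> i; apply: Ck_add; apply: IH; do ?exact: CkS.
    exact: (Ck_partial i Cg).2.
  exact: (Ck_partial i Cf).2.
Qed.

Lemma Ck_sum m k (I : Type) (r : seq I) (f : I -> 'rV[R]_m -> R) :
  (forall i, Ck k (f i)) -> Ck k (fun x => \sum_(i <- r) f i x).
Proof.
move=> Cf; elim: r => [|i r IH].
  by under eq_fun do rewrite big_nil; exact: Ck_cst.
by under eq_fun do rewrite big_cons; exact: Ck_add.
Qed.

Lemma Ck_comp m p k (g : 'rV[R]_p -> R) (f : 'rV[R]_m -> 'rV[R]_p) :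
  Ck k g -> (forall i, Ck k (fun x => f x 0 i)) -> Ck k (fun x => g (f x)).
Proof.
elim: k g => [g [cg _] Cf|k IH g Cg Cf].
  split=> // x; apply: (continuous_comp (f := f)); last exact: cg.
  by apply: continuous_rV => i; exact: (Cf i).1.
apply: (@Ck_build _ _ _ (fun j x =>
  \sum_i 'D_(delta_mx 0 i) g (f x) * 'D_(delta_mx 0 j) (fun x => f x 0 i) x)).
- move=> x; apply: (continuous_comp (f := f)); last exact: (Ck_continuous Cg).
  by apply: continuous_rV => i; exact: (Cf i).1.
- move=> j x; apply/is_derive_line.
  have := @is_derive_chain R p g (fun s => f (x + s *: delta_mx 0 j)) 0
    (fun i => 'D_(delta_mx 0 j) (fun x => f x 0 i) x).
  rewrite scale0r addr0; apply.
  + by move=> i y; have [] := (Ck_partial i Cg).1 y.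
  + by move=> i; exact: Ck_continuous (Ck_partial i Cg).2.
  + by move=> i; exact: (is_derive_line (fun x => f x 0 i) x _ _).1
      ((Ck_partial j (Cf i)).1 x).
- move=> j; apply: Ck_sum => i; apply: Ck_mul.
    apply: (IH (fun y => 'D_(delta_mx 0 i) g y)) => [|i']; last exact: CkS.
    exact: (Ck_partial i Cg).2.
  exact: (Ck_partial j (Cf i)).2.
Qed.

Lemma Cinf_partial m (g : 'rV[R]_m -> R) i :
  Cinf g -> Cinf (fun x => 'D_(delta_mx 0 i) g x).
Proof. by move=> Cg k; exact: (Ck_partial i (Cg k.+1)).2. Qed.

Lemma Cinf_is_derive m (g : 'rV[R]_m -> R) i x :
  Cinf g -> is_derive x (delta_mx 0 i) g ('D_(delta_mx 0 i) g x).
Proof. by move=> Cg; exact: (Ck_partial i (Cg 1)).1. Qed.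

Lemma Cinf_derivable m (g : 'rV[R]_m -> R) i x :
  Cinf g -> derivable g x (delta_mx 0 i).
Proof. by move=> /(Cinf_is_derive i x)[]. Qed.

Lemma Cinf_continuous m (g : 'rV[R]_m -> R) : Cinf g -> continuous g.
Proof. by move=> /(_ 0); exact: Ck_continuous. Qed.

Lemma Cinf_cst m (a : R) : Cinf (fun _ : 'rV[R]_m => a).
Proof. by move=> k; exact: Ck_cst. Qed.

Lemma Cinf_coord m i : Cinf (fun x : 'rV[R]_m => x 0 i).
Proof. by move=> k; exact: Ck_coord. Qed.

Lemma Cinf_add m (f g : 'rV[R]_m -> R) :
  Cinf f -> Cinf g -> Cinf (fun x => f x + g x).
Proof. by move=> Cf Cg k; exact: Ck_add. Qed.

Lemma Cinf_mul m (f g : 'rV[R]_m -> R) :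
  Cinf f -> Cinf g -> Cinf (fun x => f x * g x).
Proof. by move=> Cf Cg k; exact: Ck_mul. Qed.

Lemma Cinf_sub m (f g : 'rV[R]_m -> R) :
  Cinf f -> Cinf g -> Cinf (fun x => f x - g x).
Proof.
move=> Cf Cg; apply: Cinf_add => //.
by under eq_fun do rewrite -mulN1r; apply: Cinf_mul => //; exact: Cinf_cst.
Qed.

Lemma Cinf_sum m (I : Type) (r : seq I) (f : I -> 'rV[R]_m -> R) :
  (forall i, Cinf (f i)) -> Cinf (fun x => \sum_(i <- r) f i x).
Proof. by move=> Cf k; apply: Ck_sum => i; exact: Cf. Qed.

Lemma Cinf_comp m p (g : 'rV[R]_p -> R) (f : 'rV[R]_m -> 'rV[R]_p) :
  Cinf g -> (forall i, Cinf (fun x => f x 0 i)) -> Cinf (fun x => g (f x)).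
Proof. by move=> Cg Cf k; apply: Ck_comp => // i; exact: Cf. Qed.

(** Smoothness on the line, phrased by its effect on [Cinf]: this is the only form in which cutoffs
    are used, and no iterated derivative of [h] has to be computed. *)
Definition smooth1 (h : R -> R) :=
  forall m (g : 'rV[R]_m -> R), Cinf g -> Cinf (fun x => h (g x)).

Lemma Ck_comp1 m k (h h' : R -> R) (g : 'rV[R]_m -> R) :
  (forall s : R, is_derive s 1 h (h' s)) -> Cinf g ->
  Ck k (fun x => h' (g x)) -> Ck k.+1 (fun x => h (g x)).
Proof.
move=> dh Cg Ch'.
apply: (@Ck_build _ _ _ (fun i x => h' (g x) * 'D_(delta_mx 0 i) g x)).
- move=> x; apply: (continuous_comp (f := g)).
    exact: Cinf_continuous.
  by have [/derivable1_diffP/differentiable_continuous] := dh (g x).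
- move=> i x; apply/is_derive_line.
  apply: (is_derive1_comp (g := fun s => g (x + s *: delta_mx 0 i))).
    by rewrite scale0r addr0.
  by apply: (is_derive_line g x _ _).1; exact: Cinf_is_derive.
- by move=> i; apply: Ck_mul => //; exact: Cinf_partial.
Qed.

(** Meant for families such as P(1/x) exp(-1/x), where the derivatives have no convenient closed
    form but stay in the family. *)
Lemma smooth1_derive_closed (D : set (R -> R)) :
  (forall h, D h -> exists2 h', D h' & forall s : R, is_derive s 1 h (h' s)) ->
  forall h, D h -> smooth1 h.
Proof.
move=> DP h Dh m g Cg k; elim: k h Dh => [|k IH] h /DP[h' Dh' dh].
  split=> // x; apply: (continuous_comp (f := g)).
    exact: Cinf_continuous.
  by have [/derivable1_diffP/differentiable_continuous] := dh (g x).
by apply: (Ck_comp1 dh) => //; exact: IH.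
Qed.

Lemma smooth1_antiderivative (h h' : R -> R) :
  (forall s : R, is_derive s 1 h (h' s)) -> smooth1 h' -> smooth1 h.
Proof. by move=> dh Sh' m g Cg k; apply/CkS/(Ck_comp1 dh) => //; exact: Sh'. Qed.

End SmoothCalculus.

(** * Ordinary differential equations on [0, 1] *)

Section RealLine.
Context {R : realType}.

Lemma is_derive_continuous (f : R -> R) (df : R) (x : R) :
  is_derive x 1 f df -> {for x, continuous f}.
Proof. by move=> [/derivable1_diffP/differentiable_continuous]. Qed.

Lemma is_derive_eps (f : R -> R) (x l : R) :
  (forall e, 0 < e -> exists2 d, 0 < d & forall w, `|w - x| < d ->
    `|f w - f x - l * (w - x)| <= e * `|w - x|) -> is_derive x 1 f l.
Proof.
move=> H; apply/is_derive1_caratheodory.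
exists (fun w => if w == x then l else (f w - f x) / (w - x)); split.
- move=> w; case: eqP => [->|/eqP wx]; first by rewrite !subrr mulr0.
  by rewrite divfK// subr_eq0.
- rewrite /prop_for /continuous_at eqxx; apply/cvgrPdist_le => e e0.
  have [d d0 dP] := H e e0; apply/nbhs_ballP; exists d => //= w.
  rewrite /ball /= distrC => wd; case: eqP => [_|/eqP wx].
    by rewrite subrr normr0 ltW.
  have -> : l - (f w - f x) / (w - x) = - ((f w - f x - l * (w - x)) / (w - x)).
    by field; rewrite subr_eq0.
  rewrite normrN normrM normfV ler_pdivrMr ?dP//.
  by rewrite normr_gt0 subr_eq0.
- by rewrite eqxx.
Qed.

Lemma antiderivative (g : R -> R) : continuous g ->
  exists2 h : R -> R, h 0 = 0 & forall s : R, is_derive s 1 h (g s).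
Proof.
move=> cg; pose mu := @lebesgue_measure R.
pose I (a b : R) := (\int[mu]_(t in `[a, b]) g t)%R.
have int_g (a b : R) : mu.-integrable `[a, b] (EFin \o g).
  apply: continuous_compact_integrable; first exact: segment_compact.
  exact: continuous_subspaceT.
have IB (a b c : R) : a <= b -> b <= c -> I a c = I a b + (I b c - I b b).
  move=> ab bc; apply/eqP; rewrite addrC -subr_eq; apply/eqP.
  have half (a' : R) : a' <= b ->
      I a' c - I a' b = (\int[mu]_(t in `]b, c]) g t)%R.
    by move=> a'b; apply: Rintegral_itvB; rewrite ?bnd_simp//; exact: int_g.
  by rewrite !half.
(* The integral over [[b, s]] is the right primitive only when [b] lies to the left, so the base
   point moves with [s]. By [hE] every base point further left gives the same value; near [s0] it
   can be fixed at [- (|s0| + 2)]. *)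
pose h (s : R) := I (- (`|s| + 1)) s - I (- (`|s| + 1)) 0.
have hE (b s : R) : `|s| + 1 <= - b -> h s = I b s - I b 0.
  move=> sb; rewrite /h; set a := - (`|s| + 1).
  have ba : b <= a by rewrite /a lerNr.
  have as_ : a <= s by rewrite /a; have := ler_norm (- s); rewrite normrN; lra.
  have a0 : a <= 0 by rewrite /a; have := normr_ge0 s; lra.
  by rewrite (IB b a s) // (IB b a 0) //; ring.
exists h => [|s0]; first by rewrite /h subrr.
pose b := - (`|s0| + 2).
apply: (@near_eq_is_derive _ _ _ (fun s : R => I b s - I b 0)).
  near=> s; rewrite (hE b) // /b opprK.
  suff : `|s| < `|s0| + 1 by lra.
  near: s; apply/nbhs_ballP; exists 1 => //= s; rewrite /ball /= => ss0.
  by have := ler_normB s0 (s0 - s); rewrite opprB addrC subrK; lra.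
have bs0 : b < s0 by rewrite /b; have := ler_norm (- s0); rewrite normrN; lra.
have s01 : s0 < s0 + 1 by lra.
have [dI] := @continuous_FTC1_closed R g b s0 (s0 + 1) s01 (int_g _ _) bs0 (cg s0).
rewrite derive1E => eI.
by rewrite -[g s0]subr0; apply: is_deriveB; split.
Unshelve. all: by end_near. Qed.

Lemma mvt_open (f df : R -> R) (T : R) : 0 < T ->
  {within `[0, T], continuous f} ->
  (forall s : R, 0 < s < T -> is_derive s 1 f (df s)) ->
  exists2 c, 0 < c < T & f T - f 0 = df c * T.
Proof.
move=> T0 cf fdf; have fdf' (s : R) : s \in `]0, T[ -> is_derive s 1 f (df s).
  by rewrite in_itv /= => sT; exact: fdf.
have [c cT E] := MVT T0 fdf' cf; rewrite subr0 in E.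
by exists c => //; move: cT; rewrite in_itv.
Qed.

(** The mean value theorem is applied to [u s * expR (- K * s) - E * s], whose derivative is at most
    0. Taking [T <= 1] allows a bound independent of [T]. *)
Lemma gronwall (u du : R -> R) (K E T : R) : 0 <= K -> 0 <= E -> 0 <= u 0 ->
  0 <= T <= 1 -> continuous u ->
  (forall s : R, 0 < s < T -> is_derive s 1 u (du s)) ->
  (forall s : R, 0 < s < T -> du s <= K * u s + E) ->
  u T <= (u 0 + E) * expR K.
Proof.
move=> K0 E0 u0 /andP[T0 T1] cu dudu duK.
have eK : 1 <= expR K by rewrite -expR0 ler_expR.
have [TE|Tneq0] := eqVneq T 0.
  by rewrite TE -[leLHS]mulr1 ler_pM// lerDl.
have {}T0 : 0 < T by rewrite lt_def Tneq0.
pose w s := u s * expR (- K * s) - E * s.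
have dexp (s : R) : is_derive s 1 (fun s : R => expR (- K * s)) (- K * expR (- K * s)).
  rewrite mulrC; apply: is_derive1_comp.
  by apply: is_derive_eq; rewrite [LHS]mulr1.
have dw (s : R) : 0 < s < T ->
    is_derive s 1 w (u s * (- K * expR (- K * s)) + expR (- K * s) * du s - E).
  move=> sT; have := dudu s sT => dus; have := dexp s => des.
  apply: is_deriveB; last by apply: is_derive_eq; rewrite [LHS]mulr1.
  exact: is_deriveM.
have cw : {within `[0, T], continuous w}.
  apply: continuous_subspaceT => s; apply: cvgB.
    by apply: cvgM; [exact: cu|exact: is_derive_continuous].
  by apply: cvgM; [exact: cvg_cst|exact: cvg_id].
have [c cT E1] := mvt_open T0 cw dw.
have wT : w T <= w 0.
  rewrite -subr_le0 E1 pmulr_lle0 //.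
  have e0 : 0 < expR (- K * c) by exact: expR_gt0.
  have e1 : expR (- K * c) <= 1.
    rewrite -expR0 ler_expR; case/andP: cT => c0 _.
    by rewrite mulNr oppr_le0 mulr_ge0 // ltW.
  have H := duK c cT; rewrite -(ler_pM2r e0) mulrDl in H.
  have : E * expR (- K * c) <= E by rewrite -[leRHS]mulr1 ler_wpM2l.
  lra.
rewrite /w !mulr0 expR0 mulr1 subr0 in wT.
have eT : 0 < expR (K * T) by exact: expR_gt0.
have uT : u T <= (u 0 + E * T) * expR (K * T).
  have -> : u T = u T * expR (- K * T) * expR (K * T).
    by rewrite -mulrA -expRD mulNr addNr expR0 mulr1.
  by rewrite ler_pM2r //; lra.
apply: (le_trans uT); apply: ler_pM => //; do ?exact: ltW.
- by rewrite addr_ge0 // mulr_ge0 // ltW.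
- by rewrite lerD2l -[leRHS]mulr1 ler_wpM2l.
- by rewrite ler_expR -[leRHS]mulr1 ler_wpM2l.
Qed.

(** A supremum argument. Since the step works on both sides of [r1], it covers at once the passage
    to the supremum and the passage beyond it. *)
Lemma real_induction (P : R -> Prop) : P 0 ->
  (forall r1, 0 <= r1 <= 1 -> exists2 e, 0 < e & forall r r', 0 <= r ->
     r <= r' -> r' <= 1 -> `|r - r1| < e -> `|r' - r1| < e -> P r -> P r') ->
  forall r, 0 <= r <= 1 -> P r.
Proof.
move=> P0 step.
pose A := [set r : R | 0 <= r <= 1 /\ forall r', 0 <= r' <= r -> P r'].
have A0 : A 0.
  split; first by rewrite lexx ler01.
  by move=> r' /andP[r0 r1]; rewrite (_ : r' = 0)//; apply/eqP; rewrite eq_le r0 r1.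
have supA : has_sup A.
  by split; [exists 0|exists 1 => r [/andP[]]].
have s0 : 0 <= sup A by exact: (ub_le_sup supA.2 A0).
have s1 : sup A <= 1 by apply: ge_sup => [|r [/andP[]]//]; exists 0.
have [|e e0 eP] := step (sup A); first by rewrite s0.
have [r Ar rs] := sup_adherent e0 supA.
have [/andP[r0 r1] Pr] := Ar.
have rsup : r <= sup A.
  exact: (ub_le_sup supA.2).
have Pnext r' : r <= r' -> r' < sup A + e -> r' <= 1 -> P r'.
  move=> rr' r'e r'1; apply: (eP r r') => //.
  - by rewrite ltr_norml; apply/andP; split; lra.
  - by rewrite ltr_norml; apply/andP; split; lra.
  - by apply: Pr; rewrite r0 lexx.
have Anear r' : r <= r' -> r' < sup A + e -> r' <= 1 -> A r'.
  move=> rr' r'e r'1; split; first by rewrite r'1 (le_trans r0).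
  move=> q /andP[q0 qr']; have [qr|rq] := leP q r.
    by apply: Pr; rewrite q0.
  by apply: Pnext; [exact: ltW|exact: le_lt_trans qr' _|exact: le_trans qr' _].
have A1 : A 1.
  apply: (Anear 1) => //; rewrite ltNge; apply/negP => se.
  have : sup A + e / 2 <= sup A by apply: (ub_le_sup supA.2); apply: Anear; lra.
  by lra.
by move=> q q01; apply: A1.2.
Qed.

(** The continuity method: if the weak bound up to time [s] implies the strict one at [s], then [u]
    can never reach the value [c]. *)
Lemma bootstrap (u : R -> R) (c : R) : continuous u -> u 0 < c ->
  (forall s, 0 <= s <= 1 -> (forall r, 0 <= r <= s -> u r <= c) -> u s < c) ->
  forall s, 0 <= s <= 1 -> u s < c.
Proof.
move=> cu u0 uc s s01.
have s0 : 0 <= s by case/andP: s01.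
apply: (@real_induction (fun r => forall q, 0 <= q <= r -> u q < c) _ _ s s01 s);
  last by rewrite s0 lexx.
  by move=> q q0; rewrite (_ : q = 0)//; apply/eqP; rewrite eq_le andbC.
move=> r1 /andP[r10 r11].
have near_r1 (B : set R) : nbhs (u r1) B ->
    exists2 e, 0 < e & forall r, `|r - r1| < e -> B (u r).
  move=> /cu /nbhs_ballP[e /= e0 eB]; exists e => // r rr1; apply: eB.
  by rewrite /ball /= distrC.
have [ur1|ur1] := ltP (u r1) c.
  have [|e e0 eP] := near_r1 [set z | z < c]; first exact: lt_nbhsl.
  exists e => // r r' r0 rr' r'1 re r'e Pr q /andP[q0 qr'].
  have [qr|rq] := leP q r; first by apply: Pr; rewrite q0.
  apply: eP; move: re r'e; rewrite !ltr_norml => /andP[? ?] /andP[? ?].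
  by apply/andP; split; lra.
(* If the bound fails at [r1], then [u] exceeds [c] strictly at some [r0 <= r1], for otherwise [uc]
   would apply. The induction hypothesis is then false at all times close to [r1], and there is
   nothing to transfer. *)
have [r0 [/andP[r00 r0r1] ur0]] : exists r0, 0 <= r0 <= r1 /\ c < u r0.
  apply: contrapT => H; suff : u r1 < c by lra.
  apply: uc => [|r rr1]; first by rewrite r10.
  by rewrite leNgt; apply/negP => ur; apply: H; exists r.
have [r0E|r0r] := eqVneq r0 r1; last first.
  have {}r0r : r0 < r1 by rewrite lt_neqAle r0r.
  exists (r1 - r0); first by lra.
  move=> r r' r_0 _ _ re _ /(_ r0); rewrite r00 /= => /(_ _); move: re.
  by rewrite ltr_norml => /andP[? ?] H; have := H ltac:(lra); lra.
rewrite r0E in ur0.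
have [|e e0 eP] := near_r1 [set z | c < z]; first exact: lt_nbhsr.
exists e => // r r' r_0 _ _ /eP /= cr _ /(_ r); rewrite r_0 lexx => /(_ isT).
by move=> ?; lra.
Qed.

(** Freezing the time outside [0, 1] turns data that matter on [0, 1] only into functions continuous
    on the whole line. *)
Definition clamp (s : R) : R := Num.max 0 (Num.min 1 s).

Lemma clamp_itv s : 0 <= clamp s <= 1.
Proof. by rewrite /clamp le_max lexx /= ge_max ler01 /= ge_min lexx. Qed.

Lemma clamp_id s : 0 <= s <= 1 -> clamp s = s.
Proof. by move=> /andP[s0 s1]; rewrite /clamp (min_idPr s1) (max_idPr s0). Qed.

Lemma clamp_continuous : continuous clamp.
Proof.
move=> s.
apply: (@continuous_max _ R (fun=> 0) (fun x => Num.min 1 x) s); first exact: cst_continuous.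
by apply: (@continuous_min _ R (fun=> 1) id s); [exact: cst_continuous|exact: cvg_id].
Qed.

End RealLine.

(** * Picard iteration *)

Section Picard.
Context {R : realType}.

Lemma continuous_bounded_itv (u : R -> R) : continuous u ->
  exists2 C, 0 <= C & forall t, 0 <= t <= 1 -> `|u t| <= C.
Proof.
move=> cu; have cu' : continuous (fun t => `|u t|).
  by move=> t; apply: cvg_norm; exact: cu.
have [c _ cmax] := @EVT_max R (fun t => `|u t|) 0 1 ler01 (continuous_subspaceT cu').
by exists `|u c| => // t t01; apply: cmax; rewrite in_itv.
Qed.

Lemma small_geometric (C e : R) : 0 < e -> exists k : nat, C * 2^-1 ^+ k < e.
Proof.
move=> e0; have : (C * 2^-1 ^+ k) @[k --> \oo] --> (C * 0 : R).
  by apply: cvgM; [exact: cvg_cst|apply: cvg_expr; rewrite ger0_norm; lra].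
rewrite mulr0 => /cvgrPdist_lt /(_ e e0) [k _ /(_ k (leqnn k))] /=.
by rewrite sub0r normrN => /ltr_normlW; exists k.
Qed.

(** The intervals of centre [a k] and radius [2 * C * 2^-1 ^+ k] are nested, and the limit is the
    supremum of their left ends. *)
Lemma geometric_limit (a : nat -> R) (C : R) :
  (forall k, `|a k.+1 - a k| <= C * 2^-1 ^+ k) ->
  exists l, forall k, `|l - a k| <= 2 * C * 2^-1 ^+ k.
Proof.
move=> aC; pose d k := 2 * C * 2^-1 ^+ k.
have dS k : d k = d k.+1 + C * 2^-1 ^+ k by rewrite /d exprS; field.
have d0 k : 0 <= d k.
  have C0 : 0 <= C by have := aC 0%N; rewrite expr0 mulr1; apply: le_trans.
  by rewrite /d !mulr_ge0// exprn_ge0.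
have dE k : 2 * C * 2^-1 ^+ k = d k by [].
clearbody d.
have bS k : a k - d k <= a k.+1 - d k.+1.
  by have := aC k; rewrite (dS k) ler_norml => /andP[]; move: (C * _) => q; lra.
have cS k : a k.+1 + d k.+1 <= a k + d k.
  by have := aC k; rewrite (dS k) ler_norml => /andP[]; move: (C * _) => q; lra.
have bmono k j : a k - d k <= a (k + j)%N - d (k + j)%N.
  by elim: j => [|j IH]; [rewrite addn0|rewrite addnS (le_trans IH)].
have cmono k j : a (k + j)%N + d (k + j)%N <= a k + d k.
  by elim: j => [|j IH]; [rewrite addn0|rewrite addnS (le_trans _ IH)].
have bc k j : a k - d k <= a j + d j.
  have [kj|jk] := leqP k j.
    apply: (le_trans (bmono k (j - k)%N)); rewrite subnKC//.
    by have := d0 j; lra.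
  have := cmono j (k - j)%N; rewrite subnKC; last exact: ltnW.
  by have := d0 k; lra.
pose B := [set a k - d k | k in [set: nat]].
have ubB j : ubound B (a j + d j) by move=> _ [k _ <-].
have B0 : B !=set0 by exists (a 0%N - d 0%N); exists 0%N.
exists (sup B) => k; rewrite dE ler_norml; apply/andP; split.
  suff : a k - d k <= sup B by lra.
  by apply: ub_le_sup; [exists (a 0%N + d 0%N)|exists k].
suff : sup B <= a k + d k by lra.
exact: ge_sup.
Qed.

Lemma derive_comparison (e de phi dphi : R -> R) (T : R) : 0 <= T ->
  (forall s : R, is_derive s 1 e (de s)) ->
  (forall s : R, is_derive s 1 phi (dphi s)) ->
  `|e 0| <= phi 0 -> (forall s, 0 < s < T -> `|de s| <= dphi s) ->
  `|e T| <= phi T.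
Proof.
move=> T0 De Dphi e0 dle.
have [TE|Tneq0] := eqVneq T 0; first by rewrite TE.
have {}T0 : 0 < T by rewrite lt_def Tneq0.
have main (sg : R) : `|sg| = 1 -> sg * e T <= phi T.
  move=> sg1; pose w s := phi s - sg * e s.
  have dw (s : R) : is_derive s 1 w (dphi s - sg * de s).
    by apply: is_deriveB; apply: is_derive_eq.
  have cw : {within `[0, T], continuous w}.
    by apply: continuous_subspaceT => s; exact: is_derive_continuous.
  have [c cT E] := mvt_open T0 cw (fun s _ => dw s).
  have H1 : sg * e 0 <= phi 0.
    by apply: le_trans e0; rewrite -[`|e 0|]mul1r -sg1 -normrM ler_norm.
  have H2 : sg * de c <= dphi c.
    apply: le_trans (dle c cT).
    by rewrite -[`|de c|]mul1r -sg1 -normrM ler_norm.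
  have : 0 <= w T - w 0 by rewrite E mulr_ge0 ?subr_ge0// ltW.
  by rewrite /w; lra.
rewrite ler_norml; apply/andP; split.
  by have := main (-1); rewrite normrN1 => /(_ erefl); lra.
by have := main 1; rewrite normr1 => /(_ erefl); lra.
Qed.

(** Measured against the weight [expR (2 * L * t)], each Picard step halves the distance between
    successive iterates, whatever the size of [L]. A single iteration thus covers all of [0, 1],
    without gluing of short solutions. *)
Theorem picard m (f : R -> 'rV[R]_m -> 'rV[R]_m) (L : R) (x0 : 'rV[R]_m) :
  (forall y : R -> 'rV[R]_m, continuous y ->
     forall i, continuous (fun t => f t (y t) 0 i)) ->
  (forall t y z, `|f t y - f t z| <= L * `|y - z|) ->
  exists z : R -> 'rV[R]_m, [/\ continuous z, z 0 = x0 &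
    forall t : R, 0 < t < 1 -> forall i,
      is_derive t 1 (fun s => z s 0 i) (f t (z t) 0 i)].
Proof.
move=> cf fL.
wlog L0 : L fL / 0 < L.
  move=> H; apply: (H (`|L| + 1)); last by rewrite ltr_wpDl.
  move=> t y z; apply: (le_trans (fL t y z)); rewrite ler_wpM2r//.
  by have := ler_norm L; lra.
have [pr prP] : exists pr : (R -> R) -> (R -> R), forall g, continuous g ->
    pr g 0 = 0 /\ forall s : R, is_derive s 1 (pr g) (g s).
  suff /choice[pr prP] : forall g : R -> R, exists h : R -> R, continuous g ->
    h 0 = 0 /\ forall s : R, is_derive s 1 h (g s) by exists pr.
  move=> g; have [cg|ncg] := pselect (continuous g); last by exists id => /ncg.
  by have [h h0 hg] := antiderivative cg; exists h.
pose rhs y i s := f s (y s) 0 i.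
(* The iterates are constant outside [0, 1], so that estimates on [0, 1] are global; in return the
   equation holds only inside (0, 1). *)
pose T (y : R -> 'rV[R]_m) t := \row_i (x0 0 i + pr (rhs y i) (clamp t)).
have cT y : continuous y -> continuous (T y).
  move=> cy; apply: continuous_rV => i.
  under eq_fun do rewrite mxE.
  move=> t; apply: cvgD; first exact: cvg_cst.
  apply: (continuous_comp (f := clamp)); first exact: clamp_continuous.
  by apply: is_derive_continuous; apply (prP _ (cf y cy i)).2.
pose y k := iter k T (fun=> x0).
have cy k : continuous (y k).
  by elim: k => [|k IH]; [move=> t; exact: cvg_cst|exact: cT].
have yclamp k t : y k (clamp t) = y k t.
  by case: k => [//|k]; rewrite /y /= /T clamp_id// clamp_itv.
(* Any [phi] growing at least as fast as [L * |u - v|] bounds the effect of [T]. It is an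
   exponential for the convergence of the iterates, and a linear function to show that the limit is
   a fixed point. *)
have Tdiff (u v : R -> 'rV[R]_m) (phi dphi : R -> R) t : continuous u -> continuous v ->
    (forall s : R, is_derive s 1 phi (dphi s)) -> 0 <= phi 0 -> 0 <= t <= 1 ->
    (forall s, 0 < s < t -> L * `|u s - v s| <= dphi s) ->
    0 <= phi t -> `|T u t - T v t| <= phi t.
  move=> cu cv dphiP phi0 t01 ule phit; apply: rV_norm_le => // i.
  rewrite !mxE clamp_id// opprD addrACA subrr add0r.
  have [u0 ud] := prP _ (cf u cu i); have [v0 vd] := prP _ (cf v cv i).
  apply: (@derive_comparison (fun t => pr (rhs u i) t - pr (rhs v i) t)
     (fun s => rhs u i s - rhs v i s) phi dphi) => //.
  - by case/andP: t01.
  - by rewrite u0 v0 subrr normr0.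
  - move=> s st; apply: le_trans (ule s st); apply: le_trans (fL s _ _).
    by have := norm_coord_le (f s (u s) - f s (v s)) i; rewrite !mxE.
have [C C0 yC] : exists2 C, 0 <= C & forall t, 0 <= t <= 1 -> `|y 1%N t - y 0%N t| <= C.
  have [|C C0 yC] := @continuous_bounded_itv (fun t => `|y 1%N t - y 0%N t|).
    by move=> t; apply: cvg_norm; apply: cvgB; exact: cy.
  by exists C => // t /yC; rewrite normr_id.
have dexp (K : R) (s : R) : is_derive s 1 (fun s => K * expR (2 * L * s))
    (K * (2 * L) * expR (2 * L * s)).
  rewrite -mulrA; apply: is_deriveZ; rewrite [X in is_derive _ _ _ X]mulrC.
  by apply: is_derive1_comp; apply: is_derive_eq; rewrite [LHS]mulr1.
have yest k t : 0 <= t <= 1 ->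
    `|y k.+1 t - y k t| <= C * 2^-1 ^+ k * expR (2 * L * t).
  elim: k t => [|k IH] t t01.
    rewrite expr0 mulr1; apply: (le_trans (yC t t01)).
    rewrite -[leLHS]mulr1 ler_wpM2l// -expR0 ler_expR.
    by case/andP: t01 => t0 _; rewrite !mulr_ge0// ltW.
  apply: (Tdiff (y k.+1) (y k) _ _ t (cy _) (cy _) (dexp (C * 2^-1 ^+ k.+1))) => //.
  - by rewrite !mulr_ge0// ?exprn_ge0// expR_ge0.
  - move=> s /andP[s0 st]; have [t0 t1] := andP t01.
    have -> : C * 2^-1 ^+ k.+1 * (2 * L) * expR (2 * L * s) =
      L * (C * 2^-1 ^+ k * expR (2 * L * s)) by rewrite exprS; field.
    by rewrite ler_wpM2l ?(ltW L0)//; apply: IH; apply/andP; split; lra.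
  - by rewrite !mulr_ge0// ?exprn_ge0// expR_ge0.
pose C1 := C * expR (2 * L).
have C10 : 0 <= C1 by rewrite mulr_ge0// expR_ge0.
have yest1 k t : `|y k.+1 t - y k t| <= C1 * 2^-1 ^+ k.
  rewrite -(yclamp k.+1) -(yclamp k); apply: (le_trans (yest k _ (clamp_itv t))).
  rewrite /C1 mulrAC ler_wpM2r// ?exprn_ge0// ler_wpM2l// ler_expR.
  rewrite -[leRHS]mulr1 ler_wpM2l//; first by rewrite mulr_ge0// ltW.
  by case/andP: (clamp_itv t).
have [z zP] : exists z : R -> 'rV[R]_m, forall t k, `|z t - y k t| <= 2 * C1 * 2^-1 ^+ k.
  suff /choice[z zP] : forall t, exists l : 'rV[R]_m, forall k,
    `|l - y k t| <= 2 * C1 * 2^-1 ^+ k by exists z.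
  move=> t; have /choice[l lP] : forall i, exists l : R, forall k,
     `|l - y k t 0 i| <= 2 * C1 * 2^-1 ^+ k.
    move=> i; apply: geometric_limit => k; apply: le_trans (yest1 k t).
    by have := norm_coord_le (y k.+1 t - y k t) i; rewrite !mxE.
  exists (\row_i l i) => k; apply: rV_norm_le => [|i]; last by rewrite !mxE.
  by rewrite !mulr_ge0// exprn_ge0.
have cz : continuous z.
  move=> t; apply/cvgrPdist_lt => e e0.
  have e3 : 0 < e / 3 by lra.
  have [k kP] := small_geometric (2 * C1) e3.
  have /cvgrPdist_lt /(_ _ e3) := cy k t; apply: filterS => s ys.
  have -> : z t - z s = (z t - y k t) + (y k t - y k s) - (z s - y k s).
    by rewrite opprB !subrKA.
  apply: (le_lt_trans (ler_normB _ _)).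
  have := zP t k; have := zP s k; have := ler_normD (z t - y k t) (y k t - y k s).
  by move: kP ys; lra.
have zT t : 0 <= t <= 1 -> z t = T z t.
  move=> t01; apply/eqP; rewrite -subr_eq0 -normr_le0 leNgt; apply/negP => pos.
  have [k kP] := small_geometric (2 * C1 + L * (2 * C1)) pos.
  suff : `|z t - T z t| <= (2 * C1 + L * (2 * C1)) * 2^-1 ^+ k by lra.
  have -> : z t - T z t = (z t - y k.+1 t) + (T (y k) t - T z t).
    by rewrite subrKA.
  apply: (le_trans (ler_normD _ _)); rewrite mulrDl lerD//.
    apply: (le_trans (zP t k.+1)); rewrite ler_wpM2l ?mulr_ge0// exprS.
    have : 0 <= 2^-1 ^+ k :> R by exact: exprn_ge0.
    by lra.
  have [t0 t1] := andP t01.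
  pose K := L * (2 * C1) * 2^-1 ^+ k.
  have K0 : 0 <= K by rewrite !mulr_ge0// ?exprn_ge0// ltW.
  apply: (@le_trans _ _ (K * t)); last by rewrite -[leRHS]mulr1 ler_wpM2l.
  apply: (Tdiff (y k) z (fun s => K * s) (fun s => K) t (cy k) cz) => //.
  - by move=> s; apply: is_derive_eq; rewrite [LHS]mulr1.
  - by rewrite mulr0.
  - move=> s _; rewrite /K -mulrA ler_wpM2l ?(ltW L0)// distrC; exact: zP.
  - by rewrite mulr_ge0.
exists z; split=> //.
  rewrite zT ?lexx ?ler01//; apply/rowP => i; rewrite mxE clamp_id ?lexx ?ler01//.
  by rewrite (prP _ (cf z cz i)).1 addr0.
move=> t /andP[t0 t1] i.
apply: (@near_eq_is_derive _ _ _ (fun s => x0 0 i + pr (rhs z i) s)).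
  near=> s.
  have s01 : 0 <= s <= 1.
    apply/andP; split; apply: ltW; near: s; [exact: lt_nbhsr|exact: lt_nbhsl].
  by rewrite (zT s)// mxE clamp_id.
rewrite -[f _ _ _ _]add0r; apply: is_deriveD; exact: (prP _ (cf z cz i)).2.
Unshelve. all: by end_near. Qed.

End Picard.

(** * A smooth truncation of the line *)

Section Cutoff.
Context {R : realType}.

(** From exp(y) >= y^(i+1) / (i+1)! each monomial satisfies y^i exp(-y) <= (i+1)! / y. At y = 1/x
    the bound becomes K x, which controls [flat] at 0. *)
Lemma expRN_horner_le (Q : {poly R}) :
  exists2 K, 0 <= K & forall y, 0 < y -> `|Q.[y]| * expR (- y) <= K / y.
Proof.
exists (\sum_(i < size Q) `|Q`_i| * i.+1`!%:R) => [|y y0].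
  by apply: sumr_ge0 => i _; rewrite mulr_ge0.
rewrite horner_coef; apply: (@le_trans _ _ (\sum_(i < size Q) `|Q`_i| * y ^+ i * expR (- y))).
  rewrite -mulr_suml ler_wpM2r ?expR_ge0//; apply: (le_trans (ler_norm_sum _ _ _)).
  by apply: ler_sum => i _; rewrite normrM [`|y ^+ i|]ger0_norm// exprn_ge0// ltW.
rewrite mulr_suml; apply: ler_sum => i _; rewrite -!mulrA ler_wpM2l//.
rewrite ler_pdivlMr// mulrAC -exprSr expRN ler_pdivrMr ?expR_gt0//.
have /= := expR_ge1Dxn i (ltW y0).
have f0 : 0 < i.+1`!%:R :> R by rewrite ltr0n fact_gt0.
rewrite -(ler_pM2l f0) mulrDr mulr1 mulrCA divff ?gt_eqF// mulr1.
by move=> /(le_trans _); apply; rewrite lerDr ltW.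
Qed.

(** P(1/x) exp(-1/x), continued by 0. The polynomial makes the family stable under derivation: with
    y = 1/x one has d/dx = - y^2 d/dy, which sends P exp(-y) to (P - P') y^2 exp(-y). *)
Definition flat (P : {poly R}) (x : R) : R :=
  if 0 < x then P.[x^-1] * expR (- x^-1) else 0.

Lemma is_derive_flat (P : {poly R}) (x : R) :
  is_derive x 1 (flat P) (flat ((P - P^`()) * 'X^2) x).
Proof.
have [x0|x0|<-] := ltgtP 0 x.
- apply: (@near_eq_is_derive R R R (fun x : R => P.[x^-1] * expR (- x^-1))).
    by near=> y; rewrite /flat ifT//; near: y; exact: lt_nbhsr.
  have xn0 : x != 0 by rewrite gt_eqF.
  have dinv : is_derive x 1 (fun x : R => x^-1) (- x ^- 2).
    have := @is_deriveV R id x 1 1 xn0 (is_derive_id _ _).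
    by rewrite /= [_ *: _]mulr1.
  have dP : is_derive x 1 (fun x => P.[x^-1]) (P^`().[x^-1] * (- x ^- 2)).
    exact: (@is_derive1_comp _ (horner P) (fun x : R => x^-1)).
  have dE : is_derive x 1 (fun x => expR (- x^-1)) (expR (- x^-1) * x ^- 2).
    apply: (@is_derive1_comp _ expR (fun x : R => - x^-1)).
    by rewrite -[x ^- 2]opprK; apply: is_deriveN.
  apply: (is_derive_eq (is_deriveM dP dE)).
  rewrite /flat x0 hornerM hornerD hornerN hornerXn exprVn /GRing.scale /=; ring.
- apply: (@near_eq_is_derive R R R (fun=> 0)).
    by near=> y; rewrite /flat ifF//; apply/negbTE; rewrite -leNgt ltW//;
      near: y; exact: lt_nbhsl.
  by rewrite /flat ifF; [exact: is_derive_cst|rewrite lt_gtF].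
- rewrite {2}/flat ltxx.
  apply/is_derive1_caratheodory.
  (* The difference quotient at 0 multiplies by 1/z, so it is again a member of the family. *)
  exists (flat (P * 'X)); split; last by rewrite /flat ltxx.
    move=> z; rewrite {2}/flat ltxx !subr0 /flat; case: ifP => z0; last by rewrite mul0r.
    by rewrite hornerM hornerX; field; rewrite gt_eqF.
  have [K K0 KP] := expRN_horner_le (P * 'X).
  have flatK z : `|flat (P * 'X) z| <= K * `|z|.
    rewrite /flat; case: ifPn => z0; last by rewrite normr0 mulr_ge0.
    rewrite normrM [`|expR _|]ger0_norm ?expR_ge0// (gtr0_norm z0).
    by have := KP z^-1; rewrite invrK invr_gt0; apply.
  rewrite /prop_for /continuous_at {2}/flat ltxx.
  apply/cvgr0Pnorm_le => e e0; near=> z.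
  apply: (le_trans (flatK z)).
  have : `|z| <= e / (K + 1).
    near: z; apply/nbhs_ballP; exists (e / (K + 1)).
      by rewrite /= divr_gt0// ltr_wpDl.
    by move=> z; rewrite /ball /= sub0r normrN => /ltW.
  have K1 : 0 < K + 1 by rewrite ltr_wpDl.
  rewrite ler_pdivlMr// => H; apply: le_trans H; rewrite mulrC ler_wpM2l//; lra.
Unshelve. all: by end_near. Qed.

Lemma smooth1_flat (P : {poly R}) : smooth1 (flat P).
Proof.
apply: (@smooth1_derive_closed R (range flat)) => [h [Q _ <-]|]; last by exists P.
exists (flat ((Q - Q^`()) * 'X^2)); first by exists ((Q - Q^`()) * 'X^2).
exact: is_derive_flat.
Qed.

Lemma smooth1_comp (h k : R -> R) : smooth1 h -> smooth1 k -> smooth1 (h \o k).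
Proof. by move=> Sh Sk m g Cg; apply: (Sh _ (fun x => k (g x))); exact: Sk. Qed.

Lemma smooth1_mul (h k : R -> R) :
  smooth1 h -> smooth1 k -> smooth1 (fun s => h s * k s).
Proof. by move=> Sh Sk m g Cg; apply: Cinf_mul; [exact: Sh|exact: Sk]. Qed.

Lemma smooth1_cst (a : R) : smooth1 (fun=> a).
Proof. by move=> m g Cg; exact: Cinf_cst. Qed.

Lemma smooth1_affine (a b : R) : smooth1 (fun s => a + b * s).
Proof.
move=> m g Cg; apply: Cinf_add; first exact: Cinf_cst.
by apply: Cinf_mul => //; exact: Cinf_cst.
Qed.

Lemma mvt_between (f df : R -> R) (a b : R) : a <= b ->
  (forall s : R, is_derive s 1 f (df s)) ->
  exists2 c, a <= c <= b & f b - f a = df c * (b - a).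
Proof.
move=> ab fdf; have cf : {within `[a, b], continuous f}.
  by apply: continuous_subspaceT => s; exact: is_derive_continuous.
have [c cab E] := MVT_segment ab (fun s _ => fdf s) cf.
by exists c => //; move: cab; rewrite in_itv.
Qed.

(** The normalised primitive of a bump that vanishes outside (0, 1). *)
Lemma smooth_step : exists sg : R -> R, [/\ smooth1 sg, continuous sg,
  forall s, 0 <= sg s <= 1, forall s, s <= 0 -> sg s = 0 &
  forall s, 1 <= s -> sg s = 1].
Proof.
pose b (s : R) := flat 1 s * flat 1 (1 + (-1) * s).
have flat_ge0 s : 0 <= flat 1 s.
  by rewrite /flat; case: ifP => // _; rewrite hornerC mul1r expR_ge0.
have flat_gt0 s : 0 < s -> 0 < flat 1 s.
  by rewrite /flat => ->; rewrite hornerC mul1r expR_gt0.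
have b_ge0 s : 0 <= b s by rewrite mulr_ge0.
have b_le0 s : s <= 0 -> b s = 0.
  by move=> s0; rewrite /b {1}/flat ltNge s0 mul0r.
have b_ge1 s : 1 <= s -> b s = 0.
  move=> s1; rewrite /b mulrC {1}/flat ifF ?mul0r//.
  by apply/negbTE; rewrite -leNgt; lra.
have cflat P : continuous (flat P).
  by move=> s; have := is_derive_flat P s; exact: is_derive_continuous.
have cb : continuous b.
  move=> s; apply: cvgM; first exact: cflat.
  apply: (continuous_comp (f := fun s : R => 1 + (-1) * s) (g := flat 1)); last exact: cflat.
  by apply: cvgD; [exact: cvg_cst|apply: cvgM; [exact: cvg_cst|exact: cvg_id]].
have Sb : smooth1 b.
  apply: smooth1_mul; first exact: smooth1_flat.
  apply: (smooth1_comp (h := flat 1)); first exact: smooth1_flat.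
  exact: smooth1_affine.
have [B B0 dB] := antiderivative cb.
have B1 : 0 < B 1.
  have cB : {within `[0, 1], continuous B}.
    by apply: continuous_subspaceT => s; exact: is_derive_continuous.
  have [c c01 E] := mvt_open ltr01 cB (fun s _ => dB s).
  have -> : B 1 = b c by move: E; rewrite B0; lra.
  by rewrite mulr_gt0// flat_gt0; lra.
have Bmono s t : s <= t -> B s <= B t.
  move=> st; have [c _ E] := mvt_between st dB.
  by rewrite -subr_ge0 E mulr_ge0// subr_ge0.
have Ble0 s : s <= 0 -> B s = 0.
  move=> s0; have [c /andP[_ c0]] := mvt_between s0 dB.
  by rewrite B0 (b_le0 c c0) mul0r; lra.
have Bge1 s : 1 <= s -> B s = B 1.
  move=> s1; have [c /andP[c1 _]] := mvt_between s1 dB.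
  by rewrite (b_ge1 c c1) mul0r; lra.
exists (fun s => (B 1)^-1 * B s); split.
- apply: smooth1_mul; first exact: smooth1_cst.
  exact: smooth1_antiderivative dB Sb.
- by move=> s; apply: cvgM; [exact: cvg_cst|exact: is_derive_continuous].
- move=> s; rewrite mulrC ler_pdivrMr// mul1r divr_ge0 ?(ltW B1)//=; last first.
    by have [/Ble0->//|/ltW s0] := leP s 0; rewrite -(Ble0 0 (lexx _)) Bmono.
  by have [s1|/ltW/Bge1->//] := leP s 1; exact: Bmono.
- by move=> s /Ble0->; rewrite mulr0.
- by move=> s /Bge1->; rewrite mulVf// gt_eqF.
Qed.

(** A primitive of a cutoff [ch] with values in [0, 1], equal to 1 on [-1, 1] and to 0 outside (-2,
    2). The bound on [ch] gives the Lipschitz constant 1, its plateau the identity on [-1, 1], and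
    its support the bound 2. *)
Lemma smooth_truncation : exists th : R -> R, [/\ smooth1 th,
  forall s, `|s| <= 1 -> th s = s, forall s t, `|th s - th t| <= `|s - t| &
  forall s, `|th s| <= 2].
Proof.
have [sg [Ssg csg sg01 sg_le0 sg_ge1]] := smooth_step.
pose ch s := sg (2 + (-1) * s) * sg (2 + 1 * s).
have Sch : smooth1 ch.
  by apply: smooth1_mul; apply: (smooth1_comp (h := sg)) => //; exact: smooth1_affine.
have caff (a b : R) : continuous (fun s : R => a + b * s).
  move=> s; apply: cvgD; first exact: cvg_cst.
  by apply: cvgM; [exact: cvg_cst|exact: cvg_id].
have cch : continuous ch.
  move=> s; apply: cvgM.
    apply: (continuous_comp (f := fun s : R => 2 + (-1) * s) (g := sg)).
      exact: caff.
    exact: csg.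
  apply: (continuous_comp (f := fun s : R => 2 + 1 * s) (g := sg)).
    exact: caff.
  exact: csg.
have ch01 s : 0 <= ch s <= 1.
  have /andP[a0 a1] := sg01 (2 + (-1) * s); have /andP[b0 b1] := sg01 (2 + 1 * s).
  by rewrite mulr_ge0//= -[leRHS]mulr1 ler_pM.
have ch1 s : `|s| <= 1 -> ch s = 1.
  rewrite ler_norml => /andP[s1 s2]; rewrite /ch !sg_ge1 ?mulr1//; lra.
have ch0 s : 2 <= `|s| -> ch s = 0.
  rewrite /ch ler_normr => /orP[s2|s2]; last by rewrite mulrC sg_le0 ?mul0r//; lra.
  by rewrite sg_le0 ?mul0r//; lra.
have [th th0 dth] := antiderivative cch.
have thL s t : `|th s - th t| <= `|s - t|.
  wlog st : s t / s <= t.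
    move=> H; have [/H//|/ltW/H] := leP s t.
    by rewrite distrC [leRHS]distrC.
  have [c _ E] := mvt_between st dth.
  rewrite distrC E distrC normrM -[leRHS]mul1r ler_wpM2r//.
  by have /andP[a b] := ch01 c; rewrite ger0_norm.
have thle s : `|s| <= 2 -> `|th s| <= 2.
  by move=> s2; apply: le_trans s2; have := thL s 0; rewrite th0 !subr0.
exists th; split => //.
- exact: smooth1_antiderivative dth Sch.
- move=> s s1; have [c cs] := mvt_line s dth.
  by rewrite th0 subr0 ch1 ?mul1r//; exact: le_trans cs s1.
- move=> s; have [s2|s2] := leP s 2; last first.
    have [c /andP[c2 _] E] := mvt_between (ltW s2) dth.
    have thE : th s = th 2.
      move: E; rewrite ch0 ?mul0r; first by move/eqP; rewrite subr_eq0 => /eqP.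
      by rewrite ger0_norm//; lra.
    by rewrite thE thle// ger0_norm.
  have [s2'|s2'] := leP (-2) s; first by rewrite thle// ler_norml s2' s2.
  have [c /andP[_ c2] E] := mvt_between (ltW s2') dth.
  have thE : th s = th (-2).
    move: E; rewrite ch0 ?mul0r; first by move/eqP; rewrite subr_eq0 => /eqP.
    by rewrite ler0_norm; lra.
  by rewrite thE thle// normrN ger0_norm.
Qed.

End Cutoff.

(** * Smooth dependence on initial conditions *)

Section SmoothDependence.
Context {R : realType}.

Lemma uniform_bound (I : finType) (P : I -> R -> Prop) :
  (forall i C C', C <= C' -> P i C -> P i C') ->
  (forall i, exists2 C, 0 <= C & P i C) -> exists2 C, 0 <= C & forall i, P i C.
Proof.
move=> Pmono PC.
have /choice[C CP] : forall i, exists C, 0 <= C /\ P i C.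
  by move=> i; have [C C0 PiC] := PC i; exists C.
exists (\sum_i C i) => [|i]; first by apply: sumr_ge0 => i _; case: (CP i).
apply: Pmono (CP i).2; rewrite (bigD1 i)//= lerDl.
by apply: sumr_ge0 => j _; case: (CP j).
Qed.

Lemma continuous_bounded_ball m (g : 'rV[R]_m -> R) (r : R) : continuous g ->
  exists2 C, 0 <= C & forall y, `|y| <= r -> `|g y| <= C.
Proof.
move=> cg; have [r0|r0] := ltP r 0.
  by exists 0 => // y yr; have := le_lt_trans yr r0; rewrite normr_lt0.
pose A := [set y : 'rV[R]_m | forall i, `[- r, r]%classic (y ord0 i)].
have cA : compact A.
  by apply: (@rV_compact R m (fun=> `[- r, r]%classic)) => i; exact: segment_compact.
have A0 : A !=set0.
  by exists 0 => i; rewrite /= in_itv /= mxE oppr_le0 r0.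
have cg' : {within A, continuous (fun y => `|g y|)}.
  apply: continuous_subspaceT => y; apply: (continuous_comp (f := g)); first exact: cg.
  exact: norm_continuous.
have [c _ cmax] := compact_EVT_max A0 cA cg'.
exists `|g c| => // y yr; apply: cmax; rewrite inE => i /=.
by rewrite in_itv /= -ler_norml (le_trans (norm_coord_le y i)).
Qed.

(** The factor 3 arises because intermediate points are within [|y' - y| <= 2 * r] of [y], which
    itself has norm at most [r]. *)
Lemma Cinf_mvt_ball m (g : 'rV[R]_m -> R) (r : R) (y y' : 'rV[R]_m) : Cinf g ->
  `|y| <= r -> `|y'| <= r -> exists xi : 'I_m -> 'rV[R]_m,
    (forall i, `|xi i - y| <= `|y' - y| /\ `|xi i| <= 3 * r) /\
    g y' - g y = \sum_i 'D_(delta_mx 0 i) g (xi i) * (y' 0 i - y 0 i).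
Proof.
move=> Cg yr y'r.
have [xi [xiy E]] := @coordinate_mvt R m g y y' (fun i x => Cinf_derivable Cg).
exists xi; split=> // i; split=> //.
have := ler_normD (xi i - y) y; rewrite subrK.
by have := xiy i; have := ler_normB y' y; lra.
Qed.

Lemma Cinf_lipschitz_ball m (g : 'rV[R]_m -> R) (r : R) : Cinf g ->
  exists2 L, 0 <= L & forall y y', `|y| <= r -> `|y'| <= r ->
    `|g y' - g y| <= L * `|y' - y|.
Proof.
move=> Cg.
have [|i|C C0 CP] := @uniform_bound 'I_m (fun i C => forall y, `|y| <= 3 * r ->
    `|'D_(delta_mx 0 i) g y| <= C).
- by move=> i C C' CC' H y /H /le_trans; apply.
- exact/continuous_bounded_ball/Cinf_continuous/Cinf_partial.
exists (m%:R * C) => [|y y' yr y'r]; first by rewrite mulr_ge0.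
have [xi [xiP ->]] := Cinf_mvt_ball Cg yr y'r.
apply: (le_trans (ler_norm_sum _ _ _)).
have -> : m%:R * C * `|y' - y| = \sum_(i < m) C * `|y' - y|.
  by rewrite sumr_const card_ord -mulrA mulr_natl.
apply: ler_sum => i _; rewrite normrM ler_pM//; first by apply: CP; case: (xiP i).
by have := norm_coord_le (y' - y) i; rewrite !mxE.
Qed.

(** The mean value form, with the partial derivatives moved from the intermediate points to [y] at
    the cost of their Lipschitz constants. *)
Lemma Cinf_taylor_ball m (g : 'rV[R]_m -> R) (r : R) : Cinf g ->
  exists2 C, 0 <= C & forall y y', `|y| <= r -> `|y'| <= r ->
    `|g y' - g y - \sum_i 'D_(delta_mx 0 i) g y * (y' 0 i - y 0 i)|
      <= C * `|y' - y| ^+ 2.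
Proof.
move=> Cg.
have [|i|C C0 CP] := @uniform_bound 'I_m (fun i C => forall y y',
    `|y| <= 3 * r -> `|y'| <= 3 * r ->
    `|'D_(delta_mx 0 i) g y' - 'D_(delta_mx 0 i) g y| <= C * `|y' - y|).
- move=> i C C' CC' H y y' yr y'r; apply: (le_trans (H y y' yr y'r)).
  by rewrite ler_wpM2r.
- exact/Cinf_lipschitz_ball/Cinf_partial.
exists (m%:R * C) => [|y y' yr y'r]; first by rewrite mulr_ge0.
have [xi [xiP ->]] := Cinf_mvt_ball Cg yr y'r.
rewrite -sumrB; apply: (le_trans (ler_norm_sum _ _ _)).
have -> : m%:R * C * `|y' - y| ^+ 2 = \sum_(i < m) C * `|y' - y| * `|y' - y|.
  by rewrite sumr_const card_ord expr2 !mulrA -mulrA -mulrA mulr_natl !mulrA.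
apply: ler_sum => i _; have [xi1 xi2] := xiP i.
rewrite -mulrBl normrM ler_pM//.
  apply: (@le_trans _ _ (C * `|xi i - y|)); last by rewrite ler_wpM2l.
  by apply: CP => //; have := normr_ge0 y; lra.
by have := norm_coord_le (y' - y) i; rewrite !mxE.
Qed.

(** The norm of row vectors is the maximum norm, which is not differentiable. The squared Euclidean
    norm can be differentiated along a curve, as Gronwall's inequality requires, and is itself in
    [Cinf]. *)
Definition sqnorm m (x : 'rV[R]_m) : R := \sum_i x 0 i ^+ 2.

Lemma sqnorm_ge0 m (x : 'rV[R]_m) : 0 <= sqnorm x.
Proof. by apply: sumr_ge0 => i _; exact: sqr_ge0. Qed.

Lemma norm_le_sqnorm m (x : 'rV[R]_m) (C : R) :
  0 <= C -> sqnorm x <= C ^+ 2 -> `|x| <= C.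
Proof.
move=> C0 xC; apply: rV_norm_le => // i.
rewrite -(@ler_pXn2r _ 2)// ?nnegrE// real_normK ?num_real//.
apply: le_trans xC; rewrite /sqnorm (bigD1 i)//= lerDl.
by apply: sumr_ge0 => j _; exact: sqr_ge0.
Qed.

Lemma sqr_norm_le m (x : 'rV[R]_m) : `|x| ^+ 2 <= sqnorm x.
Proof.
rewrite -[leRHS]sqr_sqrtr ?sqnorm_ge0// ler_pXn2r ?nnegrE//.
by apply: norm_le_sqnorm; rewrite ?sqr_sqrtr ?sqnorm_ge0.
Qed.

Lemma sqnorm_le m (x : 'rV[R]_m) : sqnorm x <= m%:R * `|x| ^+ 2.
Proof.
have -> : m%:R * `|x| ^+ 2 = \sum_(i < m) `|x| ^+ 2.
  by rewrite sumr_const card_ord mulr_natl.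
apply: ler_sum => i _; rewrite -real_normK ?num_real//.
by rewrite ler_pXn2r ?nnegrE// norm_coord_le.
Qed.

Lemma sqnorm_continuous m (c : R -> 'rV[R]_m) :
  continuous c -> continuous (fun s => sqnorm (c s)).
Proof.
move=> cc s; apply: cvg_sum_ord => i.
have ci : c t 0 i @[t --> s] --> c s 0 i by apply: cvg_coord; exact: cc.
exact: (cvgM ci ci).
Qed.

Lemma is_derive_sqnorm m (c : R -> 'rV[R]_m) (d : 'I_m -> R) (t : R) :
  (forall i, is_derive t 1 (fun s => c s 0 i) (d i)) ->
  is_derive t 1 (fun s => sqnorm (c s)) (\sum_i 2 * c t 0 i * d i).
Proof.
move=> dc.
have := @is_derive_sum R R R m (fun i s => c s 0 i ^+ 2) t 1
  (fun i => 2 * c t 0 i * d i).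
have -> : \sum_(i < m) (fun s => c s 0 i ^+ 2) = (fun s => sqnorm (c s)).
  by apply: funext => s; rewrite fct_sumE.
apply=> i; have -> : (fun s => c s 0 i ^+ 2) = (fun s => c s 0 i) * (fun s => c s 0 i).
  by apply: funext => s; rewrite expr2.
apply: (is_derive_eq (is_deriveM (dc i) (dc i))).
by rewrite /GRing.scale /=; ring.
Qed.

Definition solves m (B : 'I_m -> 'rV[R]_m -> R) (x : 'rV[R]_m) (z : R -> 'rV[R]_m) :=
  [/\ continuous z, z 0 = x & forall t : R, 0 < t < 1 -> forall i,
    is_derive t 1 (fun s => z s 0 i) (B i (z t))].

Lemma curve_bounded m (z : R -> 'rV[R]_m) : continuous z ->
  exists2 r, 0 <= r & forall s, 0 <= s <= 1 -> `|z s| <= r.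
Proof.
move=> cz; have [|r r0 zr] := @continuous_bounded_itv R (fun s => `|z s|).
  by move=> s; apply: cvg_norm; exact: cz.
by exists r => // s /zr; rewrite normr_id.
Qed.

(** The derivative of [sqnorm q] along a curve with velocity [d]. From 2 Q (A Q + E) and 2 Q E <=
    Q^2 + E^2 come the growth rate [m * (2 * A + 1)] and the source [m * E ^+ 2] for Gronwall's
    inequality. *)
Lemma sum_growth m (q d : 'I_m -> R) (Q A E : R) :
  (forall i, `|q i| <= Q) -> (forall i, `|d i| <= A * Q + E) -> 0 <= Q ->
  \sum_i 2 * q i * d i <= m%:R * (2 * A + 1) * Q ^+ 2 + m%:R * E ^+ 2.
Proof.
move=> qQ dQ Q0.
have -> : m%:R * (2 * A + 1) * Q ^+ 2 + m%:R * E ^+ 2 =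
    \sum_(i < m) ((2 * A + 1) * Q ^+ 2 + E ^+ 2).
  by rewrite sumr_const card_ord -[RHS]mulr_natl; ring.
apply: ler_sum => i _.
have H1 : 2 * q i * d i <= 2 * (Q * (A * Q + E)).
  rewrite -mulrA ler_wpM2l//; apply: le_trans (ler_norm _) _.
  by rewrite normrM ler_pM.
have := sqr_ge0 (Q - E); rewrite !expr2 in H1 *; lra.
Qed.

(** [B] is Lipschitz on balls only, with a constant [L] for radius [r + 1]. As long as [w] is within
    1 of [z] it stays in that ball and Gronwall's inequality applies; for close initial points this
    gives a distance strictly below 1, so [bootstrap] keeps [w] there. *)
Lemma solution_lipschitz m (B : 'I_m -> 'rV[R]_m -> R) (x0 : 'rV[R]_m)
    (z : R -> 'rV[R]_m) : (forall i, Cinf (B i)) -> solves B x0 z ->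
  exists C d : R, [/\ 0 <= C, 0 < d & forall x w, `|x - x0| < d -> solves B x w ->
    forall s, 0 <= s <= 1 -> `|w s - z s| <= C * `|x - x0| /\ `|w s - z s| <= 1].
Proof.
move=> CB [cz z0 dz].
have [r r0 zr] := curve_bounded cz.
have [|i|L L0 LP] := @uniform_bound 'I_m (fun i C => forall y y', `|y| <= r + 1 ->
    `|y'| <= r + 1 -> `|B i y' - B i y| <= C * `|y' - y|).
- move=> i C C' CC' H y y' yr y'r; apply: (le_trans (H y y' yr y'r)).
  by rewrite ler_wpM2r.
- exact: Cinf_lipschitz_ball.
pose K := m%:R * (2 * L + 1).
have K0 : 0 <= K by rewrite mulr_ge0// addr_ge0// mulr_ge0.
(* Gronwall's inequality yields the factor [m * expR K] for squares. With [m.+1] one has [1 <= C]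
   even for [m = 0], hence [m * expR K <= C ^+ 2], and no square root is taken. *)
pose C := m.+1%:R * expR K.
have eK : 1 <= expR K by rewrite -expR0 ler_expR.
have C1 : 1 <= C by rewrite -[leLHS]mulr1 ler_pM// ler1n.
have mC : m%:R * expR K < C by rewrite ltr_pM2r ?expR_gt0// ltr_nat.
exists C, C^-1; split; [lra|by rewrite invr_gt0; lra|].
move=> x w xd [cw w0 dw]; pose e := `|x - x0|.
have e0 : 0 <= e by exact: normr_ge0.
have Ce : C * e < 1 by rewrite mulrC -ltr_pdivlMr ?div1r//; lra.
pose u s := sqnorm (w s - z s).
have cwz : continuous (fun s => w s - z s) by move=> s; apply: cvgB; [exact: cw|exact: cz].
have u0 : u 0 <= m%:R * e ^+ 2.
  by rewrite /u w0 z0; exact: sqnorm_le.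
have gron s : 0 <= s <= 1 -> (forall q, 0 <= q <= s -> u q <= 1) ->
    u s <= m%:R * expR K * e ^+ 2.
  move=> s01 us.
  have := @gronwall R u (fun t => \sum_i 2 * (w t - z t) 0 i * (B i (w t) - B i (z t)))
    K 0 s K0 (lexx _) (sqnorm_ge0 _) s01 (sqnorm_continuous cwz).
  rewrite addr0 => H; apply: (@le_trans _ _ (u 0 * expR K)); last first.
    by rewrite mulrAC ler_wpM2r// ltW// expR_gt0.
  apply: H => t /andP[t0 ts].
    have t1 : t < 1 by case/andP: s01 => _; exact: lt_le_trans.
    apply: is_derive_sqnorm => i; under eq_fun do rewrite !mxE.
    by apply: is_deriveB; [apply: dw|apply: dz]; rewrite t0.
  have wz1 : `|w t - z t| <= 1.
    by apply: norm_le_sqnorm; rewrite // expr1n us// !ltW.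
  have t01 : 0 <= t <= 1 by case/andP: s01 => _ s1; rewrite ltW//= ltW// (lt_le_trans ts).
  rewrite addr0; apply: (@le_trans _ _ (m%:R * (2 * L + 1) * `|w t - z t| ^+ 2 + m%:R * 0 ^+ 2)).
    apply: sum_growth => // i; first exact: norm_coord_le.
    rewrite addr0; apply: LP; first by rewrite (le_trans (zr t t01))//; lra.
    have := ler_normD (w t - z t) (z t); rewrite subrK.
    by have := zr t t01; lra.
  by rewrite expr0n /= mulr0 addr0 ler_wpM2l// sqr_norm_le.
have small : m%:R * expR K * e ^+ 2 < 1.
  apply: (@le_lt_trans _ _ (C * e)) => //.
  rewrite expr2 mulrA ler_wpM2r//; apply: (@le_trans _ _ (C * e)); last lra.
  by rewrite ler_wpM2r// ltW.
have u1 s : 0 <= s <= 1 -> u s < 1.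
  apply: bootstrap; first exact: sqnorm_continuous.
    apply: le_lt_trans small; apply: (le_trans u0).
    by rewrite mulrAC -[leLHS]mulr1 ler_wpM2l// mulr_ge0// sqr_ge0.
  by move=> q q01 uq; apply: le_lt_trans small; exact: gron.
move=> s s01; split; last first.
  by apply: norm_le_sqnorm; rewrite // expr1n ltW// u1.
apply: norm_le_sqnorm; first by rewrite mulr_ge0//; lra.
apply: (le_trans (gron s s01 _)).
  move=> q /andP[q0 qs]; rewrite ltW// u1// q0 (le_trans qs)//.
  by case/andP: s01.
rewrite exprMn ler_wpM2r ?sqr_ge0//; apply: (le_trans (ltW mC)).
by rewrite expr2 -[leLHS]mulr1 ler_wpM2l//; lra.
Qed.

(* The error [w - z - h Y] satisfies the linearised equation up to the Taylor
   remainder of [B], which is O(h^2) by [solution_lipschitz]. *)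
Lemma solution_variation m (B : 'I_m -> 'rV[R]_m -> R) (x e : 'rV[R]_m)
    (z Y : R -> 'rV[R]_m) : (forall i, Cinf (B i)) -> solves B x z ->
  continuous Y -> Y 0 = e ->
  (forall t : R, 0 < t < 1 -> forall i, is_derive t 1 (fun s => Y s 0 i)
     (\sum_j 'D_(delta_mx 0 j) (B i) (z t) * Y t 0 j)) ->
  exists C d : R, 0 < d /\ forall h w, `|h| < d -> solves B (x + h *: e) w ->
    `|w 1 - z 1 - h *: Y 1| <= C * h ^+ 2.
Proof.
move=> CB solz cY Y0 dY; have [cz z0 dz] := solz.
have [C1 [d1 [C10 d10 lip]]] := solution_lipschitz CB solz.
have [r r0 zr] := curve_bounded cz.
have [|i|C2 C20 taylor] := @uniform_bound 'I_m (fun i C => forall y y',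
    `|y| <= r + 1 -> `|y'| <= r + 1 ->
    `|B i y' - B i y - \sum_j 'D_(delta_mx 0 j) (B i) y * (y' 0 j - y 0 j)|
      <= C * `|y' - y| ^+ 2).
- move=> i C C' CC' H y y' yr y'r; apply: (le_trans (H y y' yr y'r)).
  by rewrite ler_wpM2r// sqr_ge0.
- exact: Cinf_taylor_ball.
have [|[i j]|D D0 DP] := @uniform_bound ('I_m * 'I_m)%type (fun ij C => forall y,
    `|y| <= r -> `|'D_(delta_mx 0 ij.2) (B ij.1) y| <= C).
- by move=> i C C' CC' H y /H /le_trans; apply.
- exact/continuous_bounded_ball/Cinf_continuous/Cinf_partial.
pose K := m%:R * (2 * (m%:R * D) + 1).
have K0 : 0 <= K by rewrite mulr_ge0// addr_ge0// !mulr_ge0.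
pose C3 := C2 * (C1 * `|e|) ^+ 2.
have C30 : 0 <= C3 by rewrite mulr_ge0// sqr_ge0.
pose M := m%:R * C3 ^+ 2 * expR K.
have M0 : 0 <= M by rewrite !mulr_ge0 ?sqr_ge0 ?expR_ge0.
(* The squared error is at most M h^4, and M <= (M + 1)^2 avoids a square root. The radius ensures
   that [h *: e] is shorter than [d1]. *)
exists (M + 1), (d1 / (`|e| + 1)).
have e1 : 0 < `|e| + 1 by rewrite ltr_wpDl.
split=> [|h w]; first by rewrite divr_gt0.
rewrite ltr_pdivlMr// => hd solw.
have xd : `|x + h *: e - x| < d1.
  rewrite addrC addKr normrZ; apply: le_lt_trans hd.
  by rewrite ler_wpM2l//; lra.
have lipw := lip _ _ xd solw; have [cw w0 dw] := solw.
pose q s := w s - z s - h *: Y s.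
have cq : continuous q.
  move=> s; apply: cvgB; first by apply: cvgB; [exact: cw|exact: cz].
  by apply: cvgZ; [exact: cvg_cst|exact: cY].
pose dq t i := B i (w t) - B i (z t) -
  h * \sum_j 'D_(delta_mx 0 j) (B i) (z t) * Y t 0 j.
have q0 : sqnorm (q 0) = 0.
  rewrite /q w0 z0 Y0 [x + _]addrC addrK subrr /sqnorm big1// => i _.
  by rewrite mxE expr0n.
have T01 : (0 : R) <= (1 : R) <= 1 by rewrite ler01 lexx.
have E0 : 0 <= m%:R * (C3 * h ^+ 2) ^+ 2 by rewrite mulr_ge0// sqr_ge0.
have := @gronwall R (fun s => sqnorm (q s)) (fun t => \sum_i 2 * q t 0 i * dq t i)
  K (m%:R * (C3 * h ^+ 2) ^+ 2) 1 K0 E0 (sqnorm_ge0 _) T01 (sqnorm_continuous cq).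
rewrite q0 add0r => gron.
apply: norm_le_sqnorm; first by rewrite mulr_ge0 ?sqr_ge0//; lra.
apply: (@le_trans _ _ (m%:R * (C3 * h ^+ 2) ^+ 2 * expR K)).
  apply: gron => //.
  - move=> t t01; apply: is_derive_sqnorm => i.
    have -> : (fun s => q s 0 i) = (fun s => w s 0 i - z s 0 i - h * Y s 0 i).
      by apply: funext => s; rewrite !mxE.
    apply: is_deriveB; first by apply: is_deriveB; [exact: dw|exact: dz].
    by apply: is_deriveZ; exact: dY.
  - move=> t t01.
    have t01' : 0 <= t <= 1 by case/andP: t01 => a b; rewrite !ltW.
    have [wz wz1] := lipw t t01'.
    have ztr := zr t t01'.
    apply: (@le_trans _ _ (K * `|q t| ^+ 2 + m%:R * (C3 * h ^+ 2) ^+ 2)); last first.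
      by rewrite lerD2r ler_wpM2l// sqr_norm_le.
    apply: sum_growth => // i; first exact: norm_coord_le.
    have -> : dq t i = (\sum_j 'D_(delta_mx 0 j) (B i) (z t) * q t 0 j) +
      (B i (w t) - B i (z t) -
        \sum_j 'D_(delta_mx 0 j) (B i) (z t) * (w t 0 j - z t 0 j)).
      have -> : \sum_j 'D_(delta_mx 0 j) (B i) (z t) * (w t 0 j - z t 0 j) =
          \sum_j 'D_(delta_mx 0 j) (B i) (z t) * q t 0 j +
          h * \sum_j 'D_(delta_mx 0 j) (B i) (z t) * Y t 0 j.
        rewrite mulr_sumr -big_split /=.
        by apply: eq_bigr => j _; rewrite !mxE; ring.
      by rewrite /dq; ring.
    apply: (le_trans (ler_normD _ _)); apply: lerD.
      apply: (le_trans (ler_norm_sum _ _ _)).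
      have -> : m%:R * D * `|q t| = \sum_(j < m) D * `|q t|.
        by rewrite sumr_const card_ord -mulrA mulr_natl.
      apply: ler_sum => j _; rewrite normrM ler_pM//; last exact: norm_coord_le.
      exact: (DP (i, j)).
    apply: (le_trans (taylor i _ _ _ _)).
    + by rewrite (le_trans ztr)// lerDl.
    + by have := ler_normD (w t - z t) (z t); rewrite subrK; lra.
    have -> : C3 * h ^+ 2 = C2 * (C1 * (`|h| * `|e|)) ^+ 2.
      by rewrite /C3 !exprMn real_normK ?num_real//; ring.
    rewrite ler_wpM2l// ler_pXn2r ?nnegrE ?mulr_ge0//.
    by apply: (le_trans wz); rewrite [x + _]addrC addrK normrZ.
have -> : m%:R * (C3 * h ^+ 2) ^+ 2 * expR K = M * (h ^+ 2) ^+ 2 by rewrite /M; ring.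
rewrite [leRHS]exprMn ler_wpM2r ?sqr_ge0//.
by have := sqr_ge0 M; rewrite sqrrD; lra.
Qed.

Lemma is_derive_quadratic (f : R -> R) (l C d : R) : 0 < d ->
  (forall h, `|h| < d -> `|f h - f 0 - h * l| <= C * h ^+ 2) ->
  is_derive (0 : R) 1 f l.
Proof.
move=> d0 fl; apply: is_derive_eps => e e0.
have C0 : 0 < `|C| + 1 by rewrite ltr_wpDl.
exists (Num.min d (e / (`|C| + 1))) => [|h]; first by rewrite lt_min d0 divr_gt0.
rewrite subr0 lt_min ltr_pdivlMr// => /andP[hd he].
rewrite [l * h]mulrC; apply: (le_trans (fl h hd)).
rewrite -real_normK ?num_real// expr2 mulrA ler_wpM2r//.
apply: le_trans (ltW he); rewrite mulrC ler_wpM2l//.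
by have := ler_norm C; lra.
Qed.

(** The coefficients are bounded on [0, 1] only; with clamped time they are bounded everywhere, so
    the right-hand side is globally Lipschitz. *)
Lemma linear_solution m (A : 'I_m -> 'I_m -> R -> R) (e : 'rV[R]_m) :
  (forall i j, continuous (A i j)) ->
  exists Y : R -> 'rV[R]_m, [/\ continuous Y, Y 0 = e & forall t : R, 0 < t < 1 ->
    forall i, is_derive t 1 (fun s => Y s 0 i) (\sum_j A i j t * Y t 0 j)].
Proof.
move=> cA.
have [|[i j]|D D0 DP] := @uniform_bound ('I_m * 'I_m)%type (fun ij C => forall t,
    0 <= t <= 1 -> `|A ij.1 ij.2 t| <= C).
- by move=> i C C' CC' H y /H /le_trans; apply.
- exact: continuous_bounded_itv.
pose f t (y : 'rV[R]_m) : 'rV[R]_m := \row_i \sum_j A i j (clamp t) * y 0 j.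
have cf (y : R -> 'rV[R]_m) : continuous y ->
    forall i, continuous (fun t => f t (y t) 0 i).
  move=> cy i; under eq_fun do rewrite mxE.
  move=> t; apply: cvg_sum_ord => j; apply: cvgM; last exact: (cvg_coord (cy t)).
  apply: (continuous_comp (f := clamp) (g := A i j)); first exact: clamp_continuous.
  exact: cA.
have fL t y z : `|f t y - f t z| <= m%:R * D * `|y - z|.
  apply: rV_norm_le => [|i]; first by rewrite !mulr_ge0.
  rewrite !mxE -sumrB; apply: (le_trans (ler_norm_sum _ _ _)).
  have -> : m%:R * D * `|y - z| = \sum_(j < m) D * `|y - z|.
    by rewrite sumr_const card_ord -mulrA mulr_natl.
  apply: ler_sum => j _; rewrite -mulrBr normrM ler_pM//.
    exact: (DP (i, j) _ (clamp_itv t)).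
  by have := norm_coord_le (y - z) j; rewrite !mxE.
have [Y [cY Y0 dY]] := picard e cf fL.
exists Y; split=> // t t01 i; apply: is_derive_eq; first exact: dY.
by rewrite mxE clamp_id//; case/andP: t01 => a b; rewrite !ltW.
Qed.

(** The field (x, y) -> (B(x), DB(x) y) on R^(m + m), whose solutions pair a solution of [B] with
    its derivative with respect to the initial point, in the direction of the initial y. *)
Definition variational m (B : 'I_m -> 'rV[R]_m -> R) (k : 'I_(m + m))
    (v : 'rV[R]_(m + m)) : R :=
  match fintype.split k with
  | inl i => B i (lsubmx v)
  | inr i => \sum_j 'D_(delta_mx 0 j) (B i) (lsubmx v) * rsubmx v 0 j
  end.

Lemma Cinf_variational m (B : 'I_m -> 'rV[R]_m -> R) :
  (forall i, Cinf (B i)) -> forall k, Cinf (variational B k).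
Proof.
move=> CB k.
have Cl (g : 'rV[R]_m -> R) : Cinf g -> Cinf (fun v : 'rV[R]_(m + m) => g (lsubmx v)).
  move=> Cg; apply: Cinf_comp => // i.
  by under eq_fun do rewrite mxE; exact: Cinf_coord.
rewrite /variational; case: (fintype.split k) => i; first exact: Cl.
apply: Cinf_sum => j; apply: Cinf_mul.
  by apply: (Cl (fun x => 'D_(delta_mx 0 j) (B i) x)); exact: Cinf_partial.
by under eq_fun do rewrite mxE; exact: Cinf_coord.
Qed.

Lemma continuous_rVP m (f : 'rV[R]_m -> R) :
  (forall x e, 0 < e -> exists2 d, 0 < d & forall y, `|y - x| < d -> `|f y - f x| <= e) ->
  continuous f.
Proof.
move=> H x.
apply/(@cvgrPdist_le _ R _ (nbhs (x : 'rV[R]_m))) => e e0.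
have [d d0 dP] := H x e e0.
apply: (@filterS _ (nbhs (x : 'rV[R]_m)) _ (ball (x : 'rV[R]_m) d)); last exact: nbhsx_ballx.
by move=> y; rewrite -ball_normE /= distrC [X in _ -> X <= _]distrC => /dP.
Qed.

Lemma solution_continuous m (B : 'I_m -> 'rV[R]_m -> R)
    (W : 'rV[R]_m -> R -> 'rV[R]_m) :
  (forall i, Cinf (B i)) -> (forall x, solves B x (W x)) ->
  forall i, continuous (fun x => W x 1 0 i).
Proof.
move=> CB solW i; apply: continuous_rVP => x e e0.
have [C [d [C0 d0 lip]]] := solution_lipschitz CB (solW x).
have T01 : (0 : R) <= (1 : R) <= 1 by rewrite ler01 lexx.
have C1 : 0 < C + 1 by rewrite ltr_wpDl.
exists (Num.min d (e / (C + 1))) => [|y]; first by rewrite lt_min d0 divr_gt0.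
rewrite lt_min => /andP[yd ye].
have [H _] := lip y (W y) yd (solW y) 1 T01.
have := norm_coord_le (W y 1 - W x 1) i; rewrite !mxE => /le_trans.
apply; apply: (le_trans H).
rewrite ltr_pdivlMr// in ye; apply: le_trans (ltW ye).
by rewrite mulrC ler_wpM2l//; lra.
Qed.

Theorem smooth_dependence m (B : 'I_m -> 'rV[R]_m -> R)
    (W : 'rV[R]_m -> R -> 'rV[R]_m) :
  (forall i, Cinf (B i)) -> (forall x, solves B x (W x)) ->
  forall i, Cinf (fun x => W x 1 0 i).
Proof.
move=> CB solW i k; elim: k m B W CB solW i => [|k IH] m B W CB solW i.
  by split=> //; exact: solution_continuous CB solW i.
have /choice[Y YP] : forall v : 'rV[R]_(m + m), exists Y : R -> 'rV[R]_m,
    [/\ continuous Y, Y 0 = rsubmx v & forall t : R, 0 < t < 1 -> forall i,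
      is_derive t 1 (fun s => Y s 0 i)
        (\sum_j 'D_(delta_mx 0 j) (B i) (W (lsubmx v) t) * Y t 0 j)].
  move=> v; apply: (@linear_solution m
    (fun i j t => 'D_(delta_mx 0 j) (B i) (W (lsubmx v) t))) => i' j t.
  apply: (continuous_comp (f := W (lsubmx v))
    (g := fun x => 'D_(delta_mx 0 j) (B i') x)).
    by have [cz _ _] := solW (lsubmx v); exact: cz.
  exact/Cinf_continuous/Cinf_partial.
pose V v t : 'rV[R]_(m + m) := row_mx (W (lsubmx v) t) (Y v t).
have solV v : solves (variational B) v (V v).
  have [cz z0 dz] := solW (lsubmx v); have [cY Y0 dY] := YP v.
  split.
  - apply: continuous_rV => p; under eq_fun do rewrite mxE.
    by case: (fintype.split p) => j t; apply: cvg_coord; [exact: cz|exact: cY].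
  - by rewrite /V z0 Y0 hsubmxK.
  - move=> t t01 p; rewrite /variational /V; under eq_fun do rewrite mxE.
    by rewrite row_mxKl row_mxKr; case: (fintype.split p) => j; [exact: dz|exact: dY].
(* The [j]-th partial derivative of the time-1 map at [x] is the second half of [V] at time 1,
   started at [x] and the [j]-th basis vector. The induction hypothesis applies to [V] because it
   solves the variational field for every initial point. *)
apply: (@Ck_build _ _ _ _ (fun j x => V (row_mx x (delta_mx 0 j)) 1 0 (rshift m i))).
- exact: solution_continuous CB solW i.
- move=> j x; apply/is_derive_line.
  set v := row_mx x (delta_mx 0 j).
  have lv : lsubmx v = x by rewrite row_mxKl.
  have rv : rsubmx v = delta_mx 0 j by rewrite row_mxKr.
  have [cY Y0 dY] := YP v; rewrite lv rv in Y0 dY.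
  have [C [d [d0 H]]] := solution_variation CB (solW x) cY Y0 dY.
  apply: (@is_derive_quadratic _ _ C d d0) => h hd.
  rewrite scale0r addr0 /V row_mxEr.
  apply: le_trans (H h _ hd (solW _)).
  by have := norm_coord_le (W (x + h *: delta_mx 0 j) 1 - W x 1 - h *: Y v 1) i;
    rewrite !mxE.
- move=> j; apply: (@Ck_comp _ _ _ _ (fun v => V v 1 0 (rshift m i))
    (fun x => row_mx x (delta_mx 0 j))).
    exact: (IH _ _ V (Cinf_variational CB) solV).
  move=> p; under eq_fun do rewrite mxE.
  by case: (fintype.split p) => q; [exact: Ck_coord|exact: Ck_cst].
Qed.

End SmoothDependence.

(** * Flow boxes in R^n *)

Section LocalFlow.
Context {R : realType}.

(* Truncating the coordinates of the argument around [p] makes the field bounded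
   and globally Lipschitz without changing it near [p]. *)
Lemma truncated_field n (a : 'I_n -> 'rV[R]_n -> R) (p : 'rV[R]_n) :
  (forall i, Cinf (a i)) -> exists A : 'I_n -> 'rV[R]_n -> R,
    [/\ forall i, Cinf (A i), forall i x, `|x - p| <= 1 -> A i x = a i x,
      exists2 C, 0 <= C & forall i x, `|A i x| <= C &
      exists2 L, 0 <= L & forall i x y, `|A i x - A i y| <= L * `|x - y|].
Proof.
move=> Ca; have [th [Sth th_id thL thle]] := @smooth_truncation R.
pose T (x : 'rV[R]_n) : 'rV[R]_n := \row_i (p 0 i + th (x 0 i - p 0 i)).
have Tle x : `|T x| <= `|p| + 2.
  apply: rV_norm_le => [|i]; first by rewrite addr_ge0.
  by rewrite mxE (le_trans (ler_normD _ _))// lerD// norm_coord_le.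
have TL x y : `|T x - T y| <= `|x - y|.
  apply: rV_norm_le => // i; rewrite !mxE opprD addrACA subrr add0r.
  apply: (le_trans (thL _ _)); rewrite opprB addrA subrK.
  by have := norm_coord_le (x - y) i; rewrite !mxE.
exists (fun i x => a i (T x)); split.
- move=> i; apply: Cinf_comp => // j; under eq_fun do rewrite mxE.
  apply: Cinf_add; first exact: Cinf_cst.
  by apply: Sth; apply: Cinf_sub; [exact: Cinf_coord|exact: Cinf_cst].
- move=> i x xp; suff -> : T x = x by [].
  apply/rowP => j; have xj : `|x 0 j - p 0 j| <= 1.
    by apply: le_trans xp; have := norm_coord_le (x - p) j; rewrite !mxE.
  by rewrite mxE th_id// addrC subrK.
- have [|i|C C0 CP] := @uniform_bound R 'I_n (fun i C => forall y,
      `|y| <= `|p| + 2 -> `|a i y| <= C).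
  + by move=> i C C' CC' H y /H /le_trans; apply.
  + exact/continuous_bounded_ball/Cinf_continuous.
  by exists C => // i x; exact: CP.
- have [|i|L L0 LP] := @uniform_bound R 'I_n (fun i C => forall y y',
      `|y| <= `|p| + 2 -> `|y'| <= `|p| + 2 -> `|a i y' - a i y| <= C * `|y' - y|).
  + move=> i C C' CC' H y y' yr y'r; apply: (le_trans (H y y' yr y'r)).
    by rewrite ler_wpM2r.
  + exact: Cinf_lipschitz_ball.
  exists L => // i x y; apply: (le_trans (LP i _ _ (Tle y) (Tle x))).
  by rewrite ler_wpM2l.
Qed.

(* The time [tau] is a constant extra coordinate, so that smoothness in the
   initial point and in the time is smoothness of one time-1 map. *)
Definition timed_field n (A : 'I_n -> 'rV[R]_n -> R) (k : 'I_(n + 1))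
    (w : 'rV[R]_(n + 1)) : R :=
  match fintype.split k with
  | inl i => w 0 (rshift n 0) * A i (lsubmx w)
  | inr _ => 0
  end.

Lemma solution_unique n (A : 'I_n -> 'rV[R]_n -> R) (L : R) (y z : R -> 'rV[R]_n) (s : R) :
  0 <= L -> (forall i x y, `|A i x - A i y| <= L * `|x - y|) ->
  continuous y -> continuous z -> y 0 = z 0 -> 0 <= s <= 1 ->
  (forall t : R, 0 < t < s -> forall i, is_derive t 1 (fun s => y s 0 i) (A i (y t))) ->
  (forall t : R, 0 < t < s -> forall i, is_derive t 1 (fun s => z s 0 i) (A i (z t))) ->
  y s = z s.
Proof.
move=> L0 AL cy cz yz0 s01 dy dz.
pose u t := sqnorm (y t - z t).
have cu : continuous u.
  by apply: sqnorm_continuous => t; apply: cvgB; [exact: cy|exact: cz].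
have u0 : u 0 = 0.
  by rewrite /u yz0 subrr /sqnorm big1// => i _; rewrite mxE expr0n.
pose K := n%:R * (2 * L + 1).
have K0 : 0 <= K by rewrite mulr_ge0// addr_ge0// mulr_ge0.
have u00 : 0 <= u 0 by rewrite u0.
have us : u s <= (u 0 + 0) * expR K.
  apply: (@gronwall R u (fun t => \sum_i 2 * (y t - z t) 0 i * (A i (y t) - A i (z t))))
    => // t ts.
    apply: is_derive_sqnorm => i; under eq_fun do rewrite !mxE.
    by apply: is_deriveB; [exact: dy|exact: dz].
  rewrite addr0; apply: (@le_trans _ _ (K * `|y t - z t| ^+ 2 + n%:R * 0 ^+ 2)).
    apply: sum_growth => // i; first exact: norm_coord_le.
    by rewrite addr0.
  by rewrite expr0n /= mulr0 addr0 ler_wpM2l// sqr_norm_le.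
rewrite u0 addr0 mul0r in us; apply/eqP; rewrite -subr_eq0 -normr_le0.
by apply: norm_le_sqnorm; rewrite // expr0n.
Qed.

(** [z] is assumed to satisfy the equation only while it is within [rho] of [p], since the field
    represents the derivation only there. That it does not escape before time 1 is part of the
    proof. [G] is the time-1 map of the truncated field with the time as a parameter. *)
Theorem local_flow n (a : 'I_n -> 'rV[R]_n -> R) (p : 'rV[R]_n) (rho : R) :
  (forall i, Cinf (a i)) -> 0 < rho ->
  exists (e : R) (G : 'I_n -> 'rV[R]_(n + 1) -> R),
    [/\ 0 < e, forall i, Cinf (G i) &
      forall (tau : R) (z : R -> 'rV[R]_n), `|tau| < e -> continuous z ->
        `|z 0 - p| < e ->
        (forall t : R, 0 < t < 1 -> `|z t - p| < rho -> forall i,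
           is_derive t 1 (fun s => z s 0 i) (tau * a i (z t))) ->
        forall i, z 1 0 i = G i (row_mx (z 0) (const_mx tau))].
Proof.
move=> Ca rho0.
have [A [CA Aa [C C0 CP] [L L0 LP]]] := truncated_field p Ca.
have /choice[Z ZP] : forall w : 'rV[R]_(n + 1), exists z : R -> 'rV[R]_n,
    [/\ continuous z, z 0 = lsubmx w & forall t : R, 0 < t < 1 -> forall i,
      is_derive t 1 (fun s => z s 0 i) (w 0 (rshift n 0) * A i (z t))].
  move=> w; pose tau := w 0 (rshift n 0).
  pose f (t : R) (y : 'rV[R]_n) : 'rV[R]_n := \row_i (tau * A i y).
  have cf (y : R -> 'rV[R]_n) : continuous y ->
      forall i, continuous (fun t => f t (y t) 0 i).
    move=> cy i; under eq_fun do rewrite mxE.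
    move=> t; apply: cvgM; first exact: cvg_cst.
    apply: (continuous_comp (f := y) (g := A i)); first exact: cy.
    exact: Cinf_continuous.
  have fL t y z : `|f t y - f t z| <= `|tau| * L * `|y - z|.
    apply: rV_norm_le => [|i]; first by rewrite !mulr_ge0.
    by rewrite !mxE -mulrBr normrM -mulrA ler_wpM2l.
  have [z [cz z0 dz]] := picard (lsubmx w) cf fL.
  exists z; split=> // t t01 i; apply: is_derive_eq; first exact: dz.
  by rewrite mxE.
pose W w t : 'rV[R]_(n + 1) := row_mx (Z w t) (rsubmx w).
have CB k : Cinf (timed_field A k).
  rewrite /timed_field; case: (fintype.split k) => i; last exact: Cinf_cst.
  apply: Cinf_mul; first exact: Cinf_coord.
  apply: Cinf_comp => // j; under eq_fun do rewrite mxE; exact: Cinf_coord.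
have solW w : solves (timed_field A) w (W w).
  have [cz z0 dz] := ZP w; split.
  - apply: continuous_rV => k; under eq_fun do rewrite mxE.
    case: (fintype.split k) => j t; last exact: cvg_cst.
    by apply: cvg_coord; exact: cz.
  - by rewrite /W z0 hsubmxK.
  - move=> t t01 k; rewrite /timed_field /W; under eq_fun do rewrite mxE.
    case: (fintype.split k) => j; last exact: is_derive_cst.
    by rewrite row_mxKl row_mxEr mxE; exact: dz.
pose r := Num.min rho 1 / 2.
have m0 : 0 < Num.min rho 1 by rewrite lt_min rho0 ltr01.
have r0 : 0 < r by rewrite /r divr_gt0.
have r_rho : r < rho.
  have : Num.min rho 1 <= rho by rewrite ge_min lexx.
  by rewrite /r; lra.
have r_1 : r <= 1.
  have : Num.min rho 1 <= 1 by rewrite ge_min lexx orbT.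
  by rewrite /r; lra.
(* The solution [Z] starts within [e] of [p] and has speed at most [e * C], so it stays within
   [e + e * C = r / 2]. *)
pose e := r / (2 * (C + 1)).
have C1 : 0 < 2 * (C + 1) by rewrite mulr_gt0// ltr_wpDl.
have e0 : 0 < e by rewrite divr_gt0.
have eE : e * C + e = r / 2 by rewrite /e; field; lra.
have eC : 0 <= e * C by rewrite mulr_ge0// ltW.
exists e, (fun i w => W w 1 0 (lshift 1 i)); split=> // [i|tau z taue cz zp dz i].
  exact: smooth_dependence CB solW _.
set w := row_mx (z 0) (const_mx tau).
have [cZ Z0 dZ] := ZP w.
have wtau : w 0 (rshift n 0) = tau by rewrite /w row_mxEr mxE.
rewrite wtau in dZ; rewrite /w row_mxKl in Z0.
rewrite /W row_mxEl.
have Zp s : 0 <= s <= 1 -> `|Z w s - p| < r.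
  move=> /andP[s0 s1].
  suff Zs : `|Z w s - z 0| <= e * C.
    have := ler_normD (Z w s - z 0) (z 0 - p); rewrite subrKA; lra.
  apply: rV_norm_le => // j; rewrite !mxE -Z0.
  have [sE|sneq0] := eqVneq s 0; first by rewrite sE subrr normr0.
  have {}s0 : 0 < s by rewrite lt_def sneq0.
  have cZj : {within `[0, s], continuous (fun s => Z w s 0 j)}.
    by apply: continuous_subspaceT => t; apply: cvg_coord; exact: cZ.
  have [|c cs ->] := mvt_open s0 cZj (df := fun t => tau * A j (Z w t)).
    by move=> t /andP[t0 ts]; apply: dZ; rewrite t0 (lt_le_trans ts).
  rewrite !normrM -mulrA ler_pM// ?mulr_ge0// ?(ltW taue)//.
  by rewrite -[leRHS]mulr1 ler_pM// ger0_norm// ltW.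
have zZ s : 0 <= s <= 1 -> (forall q, 0 <= q <= s -> `|z q - p| <= r) -> z s = Z w s.
  move=> s01 zr.
  apply: (@solution_unique n (fun i x => tau * A i x) (`|tau| * L)) => //.
  - by rewrite mulr_ge0.
  - by move=> j x y; rewrite -mulrBr normrM -mulrA ler_wpM2l.
  - move=> t /andP[t0 ts] j.
    have zt : `|z t - p| <= r by apply: zr; rewrite !ltW.
    rewrite Aa; last exact: le_trans zt r_1.
    apply: dz; last exact: le_lt_trans zt r_rho.
    by rewrite t0 (lt_le_trans ts)//; case/andP: s01.
  - move=> t /andP[t0 ts] j; apply: dZ.
    by rewrite t0 (lt_le_trans ts)//; case/andP: s01.
(* While [z] is within [r] of [p], it solves the truncated equation and equals [Z], which lies
   strictly inside; [bootstrap] closes the argument. *)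
have zr : forall s, 0 <= s <= 1 -> `|z s - p| < r.
  apply: bootstrap.
  - move=> s; apply: cvg_norm; apply: cvgB; first exact: cz.
    exact: cvg_cst.
  - by lra.
  - by move=> s s01 H; rewrite zZ// Zp.
rewrite zZ// ?ler01 ?lexx// => q q01; exact/ltW/zr.
Qed.

End LocalFlow.

(** * Differential structures *)

Section DifferentialStructures.
Context {R : realType}.

Lemma common_radius (I : finType) (P : I -> R -> Prop) :
  (forall i e e', e' <= e -> P i e -> P i e') ->
  (forall i, exists2 e, 0 < e & P i e) -> exists2 e, 0 < e & forall i, P i e.
Proof.
move=> Pmono Pe.
have /choice[e eP] : forall i, exists e, 0 < e /\ P i e.
  by move=> i; have [e e0 ePi] := Pe i; exists e.
exists (\big[Num.min/1]_i e i).
  by elim/big_ind: _ => // [x y x0 y0|i _]; [rewrite lt_min x0|case: (eP i)].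
move=> i; apply: Pmono (eP i).2.
by rewrite (bigD1 i)//= ge_min lexx.
Qed.

Lemma initial_open_preimage (T : Type) (F : set (T -> R)) f (V : set R) :
  F f -> open V -> initial_open F (f @^-1` V).
Proof. by move=> Ff oV O _; apply. Qed.

Lemma initial_open_sub (T : Type) (F F' : set (T -> R)) (U : set T) :
  F `<=` F' -> initial_open F U -> initial_open F' U.
Proof. by move=> FF' oU O tO FO; apply: oU => // f V /FF'; exact: FO. Qed.

Lemma diff_structure_cst (T : Type) (F : set (T -> R)) (a : R) :
  diff_structure F -> F (fun=> a).
Proof.
move=> dF; apply: (@ds_comp _ _ _ dF 0 (fun=> a) (fun _ _ => 0)); first exact: Cinf_cst.
by case.
Qed.

Lemma sub_generated (T : Type) (A : set (T -> R)) : A `<=` generated A.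
Proof. by move=> f Af F _; apply. Qed.

(** Locality survives the intersection because sets open for a smaller family of functions are open
    for a larger one. *)
Lemma generated_diff_structure (T : Type) (A : set (T -> R)) :
  diff_structure (generated A).
Proof.
split.
- by exists (fun=> 0) => F dF _; exact: diff_structure_cst.
- by move=> m g f Cg Af F dF AF; apply: (ds_comp dF Cg) => i; exact: Af.
- move=> g gP F dF AF; apply: (ds_local dF) => p.
  have [U [a [oU Up Aa ga]]] := gP p; exists U, a; split=> //.
    by apply: initial_open_sub oU => h; apply.
  exact: Aa.
Qed.

Lemma Cinf_sqnorm_sub m (y0 : 'rV[R]_m) : Cinf (fun y => sqnorm (y - y0)).
Proof.
apply: Cinf_sum => i; under eq_fun do rewrite expr2.
have Ci : Cinf (fun y : 'rV[R]_m => (y - y0) 0 i).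
  under eq_fun do rewrite !mxE.
  by apply: Cinf_sub; [exact: Cinf_coord|exact: Cinf_cst].
exact: Cinf_mul.
Qed.

(** The smoothness test for flows and curves. The neighbourhoods are sublevel sets of
    [sqnorm (Y q - Y p)], a function of [F], which makes them open in the initial topology. *)
Lemma diff_structure_local m (T : Type) (F : set (T -> R)) (Y : T -> 'rV[R]_m)
    (h : T -> R) : diff_structure F -> (forall i, F (fun q => Y q 0 i)) ->
  (forall p, exists (e : R) (a : 'rV[R]_m -> R), [/\ 0 < e, Cinf a &
     forall q, `|Y q - Y p| < e -> h q = a (Y q)]) -> F h.
Proof.
move=> dF FY hP.
have FC a : Cinf a -> F (fun q => a (Y q)).
  move=> Ca; have := @ds_comp _ _ _ dF m a (fun i q => Y q 0 i) Ca FY.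
  congr F; apply/funext => q; congr a.
  by apply/rowP => i; rewrite mxE.
apply: (ds_local dF) => p; have [e [a [e0 Ca ha]]] := hP p.
exists ((fun q => sqnorm (Y q - Y p)) @^-1` [set z | z < (e / 2) ^+ 2]),
  (fun q => a (Y q)); split.
- by apply: initial_open_preimage; [exact: (FC _ (Cinf_sqnorm_sub _))|exact: open_lt].
- rewrite /= subrr /sqnorm big1 => [|i _]; last by rewrite mxE expr0n.
  by rewrite exprn_gt0// divr_gt0.
- exact: FC.
- move=> q /= qp; apply: ha; apply: (@le_lt_trans _ _ (e / 2)); last by lra.
  by apply: norm_le_sqnorm; [lra|exact: ltW].
Qed.

(** The functions that locally extend to smooth functions on R^n. Being a differential structure
    that contains all restrictions, this set bounds the generated one from above and so provides
    local extensions. *)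
Definition local_restriction n (S : set 'rV[R]_n) : set (S -> R) :=
  [set f | forall p : S, exists (e : R) (a : 'rV[R]_n -> R), [/\ 0 < e, Cinf a &
     forall q : S, `|val q - val p| < e -> f q = a (val q)]].

(** The metric topology of [S] makes all these functions continuous, hence contains the initial
    one. *)
Lemma local_restriction_open n (S : set 'rV[R]_n) (U : set S) (p : S) :
  initial_open (local_restriction (S := S)) U -> U p ->
  exists2 e, 0 < e & forall q : S, `|val q - val p| < e -> U q.
Proof.
move=> /(_ [set V | forall p : S, V p ->
  exists2 e, 0 < e & forall q : S, `|val q - val p| < e -> V q]); apply.
- split=> [p' _|A B oA oB p' [Ap Bp]|C oC p' [V CV Vp]].
  + by exists 1.
  + have [e1 e10 e1P] := oA p' Ap; have [e2 e20 e2P] := oB p' Bp.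
    exists (Num.min e1 e2) => [|q]; first by rewrite lt_min e10.
    by rewrite lt_min => /andP[/e1P ? /e2P ?].
  + have [e e0 eP] := oC V CV p' Vp; exists e => // q /eP Vq; by exists V.
- move=> f V Lf oV p' /= Vp; have [e [a [e0 Ca fa]]] := Lf p'.
  have fpa : f p' = a (val p') by apply: fa; rewrite subrr normr0.
  have : nbhs (val p' : 'rV[R]_n) (a @^-1` V).
    by apply: (Cinf_continuous Ca); rewrite -fpa; exact: open_nbhs_nbhs.
  move=> /nbhs_ballP[d /= d0 dP].
  exists (Num.min e d) => [|q]; first by rewrite lt_min e0.
  rewrite lt_min => /andP[qe qd]; rewrite (fa q)//; apply: dP.
  by rewrite -ball_normE /= distrC.
Qed.

Lemma local_restriction_diff_structure n (S : set 'rV[R]_n) :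
  diff_structure (local_restriction (S := S)).
Proof.
split.
- exists (fun=> 0) => p; exists 1, (fun=> 0); split=> //; exact: Cinf_cst.
- move=> m g f Cg Lf p.
  have /choice[a aP] : forall i, exists a, Cinf a /\ exists2 e, 0 < e &
      forall q : S, `|val q - val p| < e -> f i q = a (val q).
    by move=> i; have [e [a [e0 Ca fa]]] := Lf i p; exists a; split=> //; exists e.
  have [|i|e e0 eP] := @common_radius 'I_m (fun i e => forall q : S,
      `|val q - val p| < e -> f i q = a i (val q)).
  + by move=> i e e' ee' H q qe; apply: H; exact: lt_le_trans ee'.
  + by case: (aP i).
  exists e, (fun x => g (\row_i a i x)); split=> //.
    by apply: Cinf_comp => // i; under eq_fun do rewrite mxE; case: (aP i).
  move=> q qe; congr g; apply/rowP => i; rewrite !mxE; exact: eP.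
- move=> g gP p; have [U [b [oU Up Lb gb]]] := gP p.
  have [e1 e10 e1P] := local_restriction_open oU Up.
  have [e2 [a [e20 Ca ba]]] := Lb p.
  exists (Num.min e1 e2), a; split=> // [|q]; first by rewrite lt_min e10.
  by rewrite lt_min => /andP[qe1 qe2]; rewrite gb ?ba//; exact: e1P.
Qed.

Lemma subspace_local_restriction n (S : set 'rV[R]_n) :
  subspace_structure (@Cinf R n) (S := S) `<=` local_restriction (S := S).
Proof.
move=> f; apply; first exact: local_restriction_diff_structure.
by move=> _ [a Ca <-] p; exists 1, a.
Qed.

Lemma diffeomorphic_coordinates (M : Type) (F : set (M -> R)) n (S : set 'rV[R]_n) :
  diffeomorphic F (subspace_structure (@Cinf R n) (S := S)) ->
  exists X : M -> 'rV[R]_n, [/\ injective X, forall i, F (fun q => X q 0 i) &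
    forall f, F f -> forall p, exists (e : R) (a : 'rV[R]_n -> R),
      [/\ 0 < e, Cinf a & forall q, `|X q - X p| < e -> f q = a (X q)]].
Proof.
move=> [phi [psi [phiK psiK sphi spsi]]]; exists (fun q => val (phi q)); split.
- by move=> q q' /val_inj /(can_inj phiK).
- move=> i; apply: (sphi (fun y : S => val y 0 i)); apply: sub_generated.
  by exists (fun y => y 0 i) => //; exact: Cinf_coord.
- move=> f /spsi /subspace_local_restriction Lf p.
  have [e [a [e0 Ca fa]]] := Lf (phi p); exists e, a; split=> // q qp.
  by rewrite -(fa (phi q) qp) /= phiK.
Qed.

End DifferentialStructures.

(** * Integral curves and flows *)

Section OneSidedDerivatives.
Context {R : realType}.

Lemma derivative_withinP (J : set R) (h : R -> R) (t l : R) :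
  has_derivative_within J h t l <->
  forall e, 0 < e -> exists2 d, 0 < d & forall w, J w -> `|w - t| < d ->
    `|h w - h t - l * (w - t)| <= e * `|w - t|.
Proof.
have quot (w : R) : w != t -> l - (h w - h t) / (w - t) =
    - ((h w - h t - l * (w - t)) / (w - t)).
  by move=> wt; field; rewrite subr_eq0.
have quotn (e w : R) : w != t -> (`|l - (h w - h t) / (w - t)| <= e) =
    (`|h w - h t - l * (w - t)| <= e * `|w - t|).
  move=> wt; rewrite quot// normrN normrM normfV ler_pdivrMr//.
  by rewrite normr_gt0 subr_eq0.
split=> [/cvgrPdist_le H e e0|H].
  have /nbhs_ballP[d /= d0 dP] := H e e0.
  exists d => // w Jw wd; have [->|wt] := eqVneq w t.
    by rewrite !subrr mulr0 subrr normr0 mulr0.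
  rewrite -quotn//; apply: dP => //.
  by rewrite /ball /= distrC.
apply/cvgrPdist_le => e e0; have [d d0 dP] := H e e0.
apply/nbhs_ballP; exists d => //= w; rewrite /ball /= distrC => wd wt Jw.
by rewrite quotn//; exact: dP.
Qed.

Lemma interval_segment (J : set R) (s t r : R) : is_interval J -> J s -> J t ->
  0 <= r <= 1 -> J (s + r * (t - s)).
Proof.
move=> iJ Js Jt /andP[r0 r1]; have [st|/ltW ts] := leP s t.
  by apply: (iJ s t) => //; apply/andP; split; nra.
by apply: (iJ t s) => //; apply/andP; split; nra.
Qed.

(** Along the clamped segment a derivative relative to [J] becomes a two-sided derivative inside (0,
    1), even if [s] or [t] is an end point of [J]. The factor [t - s] takes care of both directions
    of time. *)
Lemma segment_reparametrization (J : set R) (h : R -> R) (l : R -> R) (s t : R) :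
  is_interval J -> J s -> J t -> s != t ->
  (forall u, J u -> has_derivative_within J h u (l u)) ->
  continuous (fun r => h (s + clamp r * (t - s))) /\
  forall r : R, 0 < r < 1 -> is_derive r 1 (fun r => h (s + clamp r * (t - s)))
    ((t - s) * l (s + clamp r * (t - s))).
Proof.
move=> iJ Js Jt st dh; pose g r := s + clamp r * (t - s).
have Jg r : J (g r) by apply: interval_segment => //; exact: clamp_itv.
have cg : continuous g.
  move=> r; apply: cvgD; first exact: cvg_cst.
  by apply: cvgM; [exact: clamp_continuous|exact: cvg_cst].
have ts0 : 0 < `|t - s| by rewrite normr_gt0 subr_eq0 eq_sym.
split=> [r|r /andP[r0 r1]].
- have [d d0 dP] := (derivative_withinP _ _ _ _).1 (dh _ (Jg r)) 1 ltr01.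
  apply/cvgrPdist_le => e e0.
  pose L := `|l (g r)| + 1.
  have L0 : 0 < L by rewrite ltr_wpDl.
  have m0 : 0 < Num.min d (e / L) by rewrite lt_min d0 divr_gt0.
  have /cvgrPdist_lt /(_ _ m0) := cg r; apply: filterS => q.
  rewrite [`|g r - g q|]distrC lt_min ltr_pdivlMr// => /andP[qd qe].
  have H := dP _ (Jg q) qd; rewrite mul1r in H.
  have hq : `|h (g q) - h (g r)| <= `|g q - g r| * L.
    have := ler_normD (h (g q) - h (g r) - l (g r) * (g q - g r)) (l (g r) * (g q - g r)).
    by rewrite subrK normrM /L; lra.
  by rewrite distrC; apply: le_trans hq (ltW qe).
- apply: is_derive_eps => e e0.
  have e' : 0 < e / `|t - s| by rewrite divr_gt0.
  have [d d0 dP] := (derivative_withinP _ _ _ _).1 (dh _ (Jg r)) _ e'.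
  exists (Num.min (d / `|t - s|) (Num.min r (1 - r))).
    by rewrite !lt_min divr_gt0//= r0 subr_gt0.
  move=> w; rewrite !lt_min ltr_pdivlMr// !ltr_norml => /and3P[wd /andP[w1 w2] /andP[w3 w4]].
  have gE : g w - g r = (w - r) * (t - s).
    rewrite /g (clamp_id (s := w)); last by apply/andP; split; lra.
    by rewrite (clamp_id (s := r)); [ring|apply/andP; split; lra].
  have := dP _ (Jg w); rewrite gE normrM => /(_ wd).
  rewrite -/(g w) -/(g r) => H.
  rewrite (_ : (t - s) * l (g r) * (w - r) = l (g r) * ((w - r) * (t - s))); last by ring.
  by apply: (le_trans H); rewrite [`|w - r| * _]mulrC mulrA divfK// gt_eqF.
Qed.

End OneSidedDerivatives.

Section RowVectorEstimates.
Context {R : realType}.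

Lemma Cinf_map_near m p (g : 'rV[R]_m -> 'rV[R]_p) (y0 : 'rV[R]_m) (e : R) :
  (forall i, Cinf (fun y => g y 0 i)) -> 0 < e ->
  exists2 d, 0 < d & forall y, `|y - y0| < d -> `|g y - g y0| < e.
Proof.
move=> Cg e0; have cg : continuous g.
  by apply: continuous_rV => i; exact: Cinf_continuous.
have : nbhs (y0 : 'rV[R]_m) (g @^-1` ball (g y0) e).
  by apply: cg; exact: nbhsx_ballx.
move=> /nbhs_ballP[d /= d0 dP]; exists d => // y yd.
have /dP : ball (y0 : 'rV[R]_m) d y by rewrite -ball_normE /= distrC.
by rewrite /= -ball_normE /= distrC.
Qed.

Lemma row_mx_near m (x x' : 'rV[R]_m) (s s' d : R) :
  `|row_mx x (const_mx s : 'rV_1) - row_mx x' (const_mx s')| < d <->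
  `|x - x'| < d /\ `|s - s'| < d.
Proof.
set w := row_mx x (const_mx s); set w' := row_mx x' (const_mx s').
split=> [wd|[xd sd]].
  split.
    apply: le_lt_trans wd; apply: rV_norm_le => // i.
    have := norm_coord_le (w - w') (lshift 1 i).
    by rewrite mxE [(- w') _ _]mxE !row_mxEl !mxE.
  apply: le_lt_trans wd; have := norm_coord_le (w - w') (rshift m 0).
  by rewrite mxE [(- w') _ _]mxE !row_mxEr !mxE.
apply: (@le_lt_trans _ _ (Num.max `|x - x'| `|s - s'|)); last by rewrite gt_max xd.
apply: rV_norm_le => [|k]; first by rewrite le_max normr_ge0.
rewrite mxE [(- w') _ _]mxE !mxE; case: (fintype.split k) => j.
  rewrite le_max; apply/orP; left.
  by have := norm_coord_le (x - x') j; rewrite !mxE.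
by rewrite !mxE le_max lexx orbT.
Qed.

Lemma ratio_between (r r' : R) : 0 <= r -> r <= r' ->
  exists2 q, 0 <= q <= 1 & r = q * r'.
Proof.
move=> r0 rr'; have [r'0|r'0] := eqVneq r' 0.
  by exists 1; rewrite ?ler01 ?lexx//; rewrite r'0 in rr' *; lra.
have r'p : 0 < r' by rewrite lt_def r'0 (le_trans r0).
exists (r / r'); last by rewrite divfK.
by rewrite divr_ge0 ?(ltW r'p)//= ler_pdivrMr// mul1r.
Qed.

End RowVectorEstimates.

(** * Uniqueness and union of integral curves *)

Section Flow.
Context {R : realType} {M : Type} {n : nat}.
Variables (F : set (M -> R)) (v : (M -> R) -> (M -> R)) (X : M -> 'rV[R]_n).
Hypothesis Xinj : injective X.
Hypothesis FX : forall i, F (fun q => X q 0 i).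
Hypothesis Floc : forall f, F f -> forall p,
  exists (e : R) (a : 'rV[R]_n -> R), [/\ 0 < e, Cinf a &
    forall q, `|X q - X p| < e -> f q = a (X q)].
Hypothesis vF : forall f, F f -> F (v f).

Lemma integral_curve_interval (J : set R) (c : R -> M) :
  integral_curve F v J c -> is_interval J.
Proof. by move=> [/connected_intervalP]. Qed.

Lemma integral_curve_scale (J : set R) (c : R -> M) (t r : R) :
  integral_curve F v J c -> J t -> 0 <= r <= 1 -> J (r * t).
Proof.
move=> cJ Jt r01; have [_ J0 _] := cJ.
have := interval_segment (integral_curve_interval cJ) J0 Jt r01.
by rewrite subr0 add0r.
Qed.

Lemma segment_curve (J : set R) (c : R -> M) (s t : R) :
  integral_curve F v J c -> J s -> J t ->
  continuous (fun r => X (c (s + clamp r * (t - s)))) /\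
  forall r : R, 0 < r < 1 -> forall i,
    is_derive r 1 (fun r => X (c (s + clamp r * (t - s))) 0 i)
      ((t - s) * v (fun q => X q 0 i) (c (s + clamp r * (t - s)))).
Proof.
move=> cJ Js Jt; have iJ := integral_curve_interval cJ.
(* This case absorbs one-point intervals, on which an integral curve need not satisfy any
   equation. *)
have [->|st] := eqVneq s t.
  under eq_fun do rewrite subrr mulr0 addr0.
  split=> [r|r _ i]; first exact: cvg_cst.
  under eq_fun do rewrite subrr mulr0 addr0.
  by rewrite subrr mul0r; exact: is_derive_cst.
have dJ f : F f -> forall u, J u -> has_derivative_within J (f \o c) u (v f (c u)).
  have [_ _ [[u JE]|[_ H]]] := cJ; last exact: H.
  by move: Js Jt st; rewrite JE => /= -> ->; rewrite eqxx.
have rep i := segment_reparametrization iJ Js Jt st (dJ _ (FX i)).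
split=> [|r r01 i]; first by apply: continuous_rV => i; exact: (rep i).1.
exact: (rep i).2.
Qed.

(** One radius and one map serve all integral curves passing near [p], at any time [s]: the box does
    not produce curves, it predicts those that exist. *)
Lemma flowbox p : exists (e : R) (G : 'rV[R]_(n + 1) -> 'rV[R]_n),
  [/\ 0 < e, forall i, Cinf (fun w => G w 0 i) &
    forall J c s t, integral_curve F v J c -> J s -> J t ->
      `|t - s| < e -> `|X (c s) - X p| < e ->
      X (c t) = G (row_mx (X (c s)) (const_mx (t - s)))].
Proof.
have /choice[a aP] : forall i, exists a, Cinf a /\ exists2 e, 0 < e &
    forall q, `|X q - X p| < e -> v (fun q => X q 0 i) q = a (X q).
  move=> i; have [e [a [e0 Ca H]]] := Floc (vF (FX i)) p.
  by exists a; split=> //; exists e.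
have [|i|rho rho0 rhoP] := @common_radius R 'I_n (fun i e => forall q,
    `|X q - X p| < e -> v (fun q => X q 0 i) q = a i (X q)).
- by move=> i e e' ee' H q qe; apply: H; exact: lt_le_trans ee'.
- by case: (aP i).
have [e [G [e0 CG GP]]] := local_flow (X p) (fun i => (aP i).1) rho0.
exists e, (fun w => \row_i G i w); split=> [//|i|J c s t cJ Js Jt ts cs].
  by under eq_fun do rewrite mxE; exact: CG.
have [cz dz] := segment_curve cJ Js Jt.
have q0 : c (s + clamp 0 * (t - s)) = c s.
  by rewrite clamp_id ?lexx ?ler01// mul0r addr0.
have q1 : c (s + clamp 1 * (t - s)) = c t.
  by rewrite clamp_id ?lexx ?ler01// mul1r addrC subrK.
apply/rowP => i; rewrite mxE.
have := GP (t - s) (fun r => X (c (s + clamp r * (t - s)))) ts cz.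
rewrite q0 q1 => /(_ cs); apply=> r r01 rp j.
by apply: is_derive_eq; [exact: dz|rewrite rhoP].
Qed.

(** Times are written as fractions [r * t] of a final time, so that induction over [0, 1] handles
    positive and negative [t] alike. *)
Lemma near_time (J : set R) (c : R -> M) (t r1 e : R) :
  integral_curve F v J c -> J t -> 0 <= r1 <= 1 -> 0 < e ->
  exists2 d, 0 < d & forall r r', 0 <= r <= 1 -> 0 <= r' <= 1 ->
    `|r - r1| < d -> `|r' - r1| < d ->
    `|r' * t - r * t| < e /\ `|X (c (r * t)) - X (c (r1 * t))| < e.
Proof.
move=> cJ Jt r101 e0; have [_ J0 _] := cJ.
have [cz _] := segment_curve cJ J0 Jt.
have /cvgrPdist_lt /(_ e e0) /nbhs_ballP[d /= d0 dP] := cz r1.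
have t1 : 0 < 2 * (`|t| + 1) by rewrite mulr_gt0// ltr_wpDl.
exists (Num.min d (e / (2 * (`|t| + 1)))) => [|r r' r01 r'01].
  by rewrite lt_min d0 divr_gt0.
rewrite !lt_min => /andP[rd re] /andP[r'd r'e]; split.
  rewrite -mulrBl normrM.
  have rr' : `|r' - r| <= `|r' - r1| + `|r - r1|.
    by rewrite [`|r - r1|]distrC -[r' - r](subrKA r1) ler_normD.
  rewrite ltr_pdivlMr// in re; rewrite ltr_pdivlMr// in r'e.
  have := normr_ge0 t; have := normr_ge0 (r' - r1); have := normr_ge0 (r - r1).
  by have := ler_wpM2r (normr_ge0 t) rr'; nra.
have := dP r; rewrite /ball /= [`|r1 - r|]distrC => /(_ rd).
by rewrite !clamp_id// subr0 !add0r distrC.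
Qed.

Lemma integral_curve_unique (J1 J2 : set R) (c1 c2 : R -> M) (t : R) :
  integral_curve F v J1 c1 -> integral_curve F v J2 c2 -> c1 0 = c2 0 ->
  J1 t -> J2 t -> c1 t = c2 t.
Proof.
move=> cJ1 cJ2 c0 J1t J2t; apply: Xinj.
suff /(_ 1) : forall r, 0 <= r <= 1 -> X (c1 (r * t)) = X (c2 (r * t)).
  by rewrite mul1r; apply; rewrite ler01 lexx.
apply: real_induction => [|r1 r101]; first by rewrite mul0r c0.
have [e [G [e0 _ GP]]] := flowbox (c1 (r1 * t)).
have [d d0 dP] := near_time cJ1 J1t r101 e0.
exists d => // r r' r0 rr' r'1 rd r'd E.
have r01 : 0 <= r <= 1 by rewrite r0 (le_trans rr').
have r'01 : 0 <= r' <= 1 by rewrite r'1 (le_trans r0).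
have [te ce] := dP r r' r01 r'01 rd r'd.
(* The box is centred on the first curve. The second one is close to the centre because both agree
   at time [r * t]; at [r1 * t] they are not yet known to agree. *)
have ce2 : `|X (c2 (r * t)) - X (c1 (r1 * t))| < e by rewrite -E.
have J1r q (q01 : 0 <= q <= 1) := integral_curve_scale cJ1 J1t q01.
have J2r q (q01 : 0 <= q <= 1) := integral_curve_scale cJ2 J2t q01.
rewrite (GP _ _ _ _ cJ1 (J1r r r01) (J1r r' r'01) te ce).
by rewrite (GP _ _ _ _ cJ2 (J2r r r01) (J2r r' r'01) te ce2) E.
Qed.

(** The domain of the future maximal curve through [x]. *)
Definition reach (x : M) : set R :=
  [set t | exists (J : set R) (c : R -> M),
    [/\ integral_curve F v J c, c 0 = x & J t]].

Lemma integral_curve_point x : integral_curve F v [set 0] (fun=> x).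
Proof. by split; [exact: connected1| |left; exists 0]. Qed.

Lemma reach0 x : reach x 0.
Proof. by exists [set 0], (fun=> x); split=> //; exact: integral_curve_point. Qed.

Lemma reach_scale x t r : reach x t -> 0 <= r <= 1 -> reach x (r * t).
Proof.
move=> [J [c [cJ c0 Jt]]] r01; exists J, c; split=> //.
exact: integral_curve_scale cJ Jt r01.
Qed.

Lemma reach_interval x : is_interval (reach x).
Proof.
move=> s t Ws Wt z /andP[sz zt]; have [z0|/ltW z0] := leP 0 z.
  by have [q q01 ->] := ratio_between z0 zt; exact: reach_scale.
have Nz0 : 0 <= - z by rewrite oppr_ge0.
have szN : - z <= - s by rewrite lerN2.
have [q q01 E] := ratio_between Nz0 szN.
have -> : z = q * s by move: E; rewrite mulrN => /oppr_inj.
exact: reach_scale.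
Qed.

Lemma flow_map_exists : exists Phi : M * R -> M, forall J c t,
  integral_curve F v J c -> J t -> Phi (c 0, t) = c t.
Proof.
have /choice[Phi PhiP] : forall p : M * R, exists y, forall J c,
    integral_curve F v J c -> c 0 = p.1 -> J p.2 -> y = c p.2.
  move=> p; have [[J [c [cJ c0 Jt]]]|np] := pselect (reach p.1 p.2).
    exists (c p.2) => J' c' cJ' c'0 J't.
    by apply: (integral_curve_unique cJ cJ') => //; rewrite c0.
  (* Where no curve arrives the value is arbitrary. *)
  by exists p.1 => J c cJ c0 Jt; exfalso; apply: np; exists J, c.
by exists Phi => J c t cJ Jt; exact: (PhiP (c 0, t) J c).
Qed.

(** * Smoothness of the union flow *)

Variable Phi : M * R -> M.
Hypothesis PhiP : forall J c t, integral_curve F v J c -> J t -> Phi (c 0, t) = c t.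

Lemma Phi0 x : Phi (x, 0) = x.
Proof. exact: (PhiP (t := 0) (integral_curve_point x)). Qed.

(** A curve that reaches [t] also reaches every [r * t], so both times lie on a single integral
    curve, to which the box applies. *)
Lemma flowbox_Phi p : exists (e : R) (G : 'rV[R]_(n + 1) -> 'rV[R]_n),
  [/\ 0 < e, forall i, Cinf (fun w => G w 0 i) &
    forall x t r, reach x t -> 0 <= r <= 1 ->
      `|t - r * t| < e -> `|X (Phi (x, r * t)) - X p| < e ->
      X (Phi (x, t)) = G (row_mx (X (Phi (x, r * t))) (const_mx (t - r * t)))].
Proof.
have [e [G [e0 CG GP]]] := flowbox p; exists e, G; split=> // x t r.
move=> [J [c [cJ <- Jt]]] r01; have Jrt := integral_curve_scale cJ Jt r01.
by rewrite (PhiP cJ Jt) (PhiP cJ Jrt) => te ce; exact: GP cJ Jrt Jt te ce.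
Qed.

Lemma near_time_Phi x t r1 e : reach x t -> 0 <= r1 <= 1 -> 0 < e ->
  exists2 d, 0 < d & forall r r', 0 <= r <= 1 -> 0 <= r' <= 1 ->
    `|r - r1| < d -> `|r' - r1| < d ->
    `|r' * t - r * t| < e /\ `|X (Phi (x, r * t)) - X (Phi (x, r1 * t))| < e.
Proof.
move=> [J [c [cJ <- Jt]]] r101 e0.
have [d d0 dP] := near_time cJ Jt r101 e0; exists d => // r r' r01 r'01 rd r'd.
rewrite (PhiP cJ (integral_curve_scale cJ Jt r01)).
rewrite (PhiP cJ (integral_curve_scale cJ Jt r101)).
exact: dP.
Qed.

(** Real induction along the curve of [x0], composing the current extension with one more box.
    Neighbours of [x0] need not live until the time considered, so [g] only has to agree with [Phi]
    at those that do. *)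
Lemma time_map_smooth x0 t0 : reach x0 t0 -> forall r, 0 <= r <= 1 ->
  exists (d : R) (g : 'rV[R]_n -> 'rV[R]_n),
    [/\ 0 < d, forall i, Cinf (fun y => g y 0 i) &
      forall x, `|X x - X x0| < d -> reach x (r * t0) ->
        X (Phi (x, r * t0)) = g (X x)].
Proof.
move=> W0; apply: real_induction => [|r1 r101].
  exists 1, id; split=> // [i|x _ _]; first exact: Cinf_coord.
  by rewrite mul0r Phi0.
have [e [G [e0 CG GP]]] := flowbox_Phi (Phi (x0, r1 * t0)).
have e2 : 0 < e / 2 by lra.
have [eta eta0 etaP] := near_time_Phi W0 r101 e2.
exists eta => // r r' r0 rr' r'1 rd r'd [d [g [d0 Cg gP]]].
have r01 : 0 <= r <= 1 by rewrite r0 (le_trans rr').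
have r'01 : 0 <= r' <= 1 by rewrite r'1 (le_trans r0).
have [te ce] := etaP r r' r01 r'01 rd r'd.
have [d' d'0 d'P] := Cinf_map_near (X x0) Cg e2.
(* The earlier time is a fraction of the later one; a neighbour that reaches the later time
   therefore reaches the earlier one too. *)
have [q q01 rE] := ratio_between r0 rr'.
exists (Num.min d d'), (fun y => G (row_mx (g y) (const_mx (r' * t0 - r * t0)))); split.
- by rewrite lt_min d0.
- move=> i; apply: (Cinf_comp (g := fun w => G w 0 i)) => // k.
  under eq_fun do rewrite mxE.
  case: (fintype.split k) => j; first exact: Cg.
  by under eq_fun do rewrite mxE; exact: Cinf_cst.
- move=> x; rewrite lt_min => /andP[xd xd'] Wx.
  have rtE : r * t0 = q * (r' * t0) by rewrite rE mulrA.
  have Wxr : reach x (r * t0) by rewrite rtE; exact: reach_scale.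
  have gx0 : g (X x0) = X (Phi (x0, r * t0)).
    by rewrite gP// ?subrr ?normr0//; exact: reach_scale.
  have close : `|X (Phi (x, r * t0)) - X (Phi (x0, r1 * t0))| < e.
    rewrite gP//; have := d'P _ xd'; rewrite gx0 => H.
    have := ler_normD (g (X x) - X (Phi (x0, r * t0)))
      (X (Phi (x0, r * t0)) - X (Phi (x0, r1 * t0))).
    by rewrite subrKA; lra.
  rewrite -(gP x)// rtE; apply: GP => //; rewrite -rtE//.
  by apply: lt_trans te _; lra.
Qed.

(** Points are carried to a fixed time [r * t0] just before [t0], and from there one box leads to
    all times near [t0], smoothly in point and time together. [r * t0] must lie between 0 and every
    such time, so that it is reached as well. *)
Lemma flow_map_smooth x0 t0 : reach x0 t0 ->
  exists (d : R) (G : 'rV[R]_(n + 1) -> 'rV[R]_n),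
    [/\ 0 < d, forall i, Cinf (fun w => G w 0 i) &
      forall x t, `|X x - X x0| < d -> `|t - t0| < d -> reach x t ->
        X (Phi (x, t)) = G (row_mx (X x) (const_mx t))].
Proof.
move=> W0; have [e [G [e0 CG GP]]] := flowbox_Phi (Phi (x0, t0)).
have e2 : 0 < e / 2 by lra.
have T01 : (0 : R) <= (1 : R) <= 1 by rewrite ler01 lexx.
have [r [d1 [r01 d10 [te ce] between]]] : exists r d1 : R, [/\ 0 <= r <= 1, 0 < d1,
    `|t0 - r * t0| < e / 2 /\ `|X (Phi (x0, r * t0)) - X (Phi (x0, t0))| < e / 2 &
    forall t, `|t - t0| < d1 -> exists2 q, 0 <= q <= 1 & r * t0 = q * t].
  have [t00|t00] := eqVneq t0 0.
    exists 0, 1; rewrite t00; split=> //; first by rewrite lexx ler01.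
      by rewrite mul0r !subrr !normr0.
    by move=> t _; exists 0; rewrite ?lexx ?ler01// !mul0r.
  have [eta eta0 etaP] := near_time_Phi W0 T01 e2.
  (* [eta / 2] keeps [r] strictly within [eta] of 1 and strictly below 1; the radius
     [(1 - r) * |t0|] is the distance from [r * t0] to [t0]. *)
  pose r := Num.max 0 (1 - eta / 2).
  have r0 : 0 <= r by rewrite le_max lexx.
  have r1 : r < 1 by rewrite gt_max ltr01/=; lra.
  have reta : 1 - eta / 2 <= r by rewrite le_max lexx orbT.
  have t0p : 0 < `|t0| by rewrite normr_gt0.
  exists r, ((1 - r) * `|t0|); split.
  - by rewrite r0 ltW.
  - by rewrite mulr_gt0// subr_gt0.
  - have := etaP r 1; rewrite !mul1r; apply=> //; first by rewrite r0 ltW.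
      by rewrite distrC ger0_norm; lra.
    by rewrite subrr normr0.
  - move=> t; have [t0_pos|t0_neg] := ltP 0 t0.
      rewrite (gtr0_norm t0_pos) ltr_norml => /andP[H1 H2]; apply: ratio_between.
        by rewrite mulr_ge0// ltW.
      lra.
    rewrite (ler0_norm t0_neg) ltr_norml => /andP[H1 H2].
    have [||q q01 E] := @ratio_between R (- (r * t0)) (- t).
    - by rewrite oppr_ge0 mulr_ge0_le0.
    - lra.
    by exists q => //; move: E; rewrite mulrN => /oppr_inj.
have [d2 [g [d20 Cg gP]]] := time_map_smooth W0 r01.
have [d3 d30 d3P] := Cinf_map_near (X x0) Cg e2.
exists (Num.min (Num.min d1 d2) (Num.min d3 (e / 2))),
  (fun w => G (row_mx (g (lsubmx w)) (rsubmx w - const_mx (r * t0)))); split.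
- by rewrite !lt_min d10 d20 d30.
- move=> i; apply: (Cinf_comp (g := fun w => G w 0 i)) => // k.
  under eq_fun do rewrite mxE.
  case: (fintype.split k) => j.
    apply: (Cinf_comp (g := fun y => g y 0 j)) => // l.
    by under eq_fun do rewrite mxE; exact: Cinf_coord.
  under eq_fun do rewrite !mxE.
  by apply: Cinf_sub; [exact: Cinf_coord|exact: Cinf_cst].
- move=> x t; rewrite !lt_min.
  move=> /andP[/andP[_ xd2] /andP[xd3 _]] /andP[/andP[td1 _] /andP[_ tde]] Wx.
  have [q q01 rtE] := between t td1.
  have Wxr : reach x (r * t0) by rewrite rtE; exact: reach_scale.
  have gx0 : g (X x0) = X (Phi (x0, r * t0)).
    by rewrite gP// ?subrr ?normr0//; exact: reach_scale.
  have close : `|X (Phi (x, r * t0)) - X (Phi (x0, t0))| < e.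
    rewrite gP//; have := d3P _ xd3; rewrite gx0 => H.
    have := ler_normD (g (X x) - X (Phi (x0, r * t0)))
      (X (Phi (x0, r * t0)) - X (Phi (x0, t0))).
    by rewrite subrKA; lra.
  have closet : `|t - r * t0| < e.
    by have := ler_normD (t - t0) (t0 - r * t0); rewrite subrKA; lra.
  rewrite row_mxKl row_mxKr -(gP x)//.
  have -> : const_mx t - const_mx (r * t0) = const_mx (t - r * t0) :> 'rV[R]_1.
    by apply/rowP => j; rewrite !mxE.
  by rewrite rtE; apply: GP => //; rewrite -rtE.
Qed.

Lemma flow_function_smooth f x0 t0 : F f -> reach x0 t0 ->
  exists (d : R) (h : 'rV[R]_(n + 1) -> R), [/\ 0 < d, Cinf h &
    forall x t, `|X x - X x0| < d -> `|t - t0| < d -> reach x t ->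
      f (Phi (x, t)) = h (row_mx (X x) (const_mx t))].
Proof.
move=> Ff W0; have [d [G [d0 CG GP]]] := flow_map_smooth W0.
have [e [a [e0 Ca fa]]] := Floc Ff (Phi (x0, t0)).
have [d' d'0 d'P] := Cinf_map_near (row_mx (X x0) (const_mx t0)) CG e0.
have G0 : G (row_mx (X x0) (const_mx t0)) = X (Phi (x0, t0)).
  by rewrite GP// subrr normr0.
exists (Num.min d d'), (fun w => a (G w)); split.
- by rewrite lt_min d0.
- exact: Cinf_comp.
- move=> x t; rewrite !lt_min => /andP[xd xd'] /andP[td td'] Wx.
  rewrite -GP//; apply: fa; rewrite GP// -G0; apply: d'P.
  by apply/row_mx_near.
Qed.

Lemma Cinf_line_id : Cinf_line (@id R).
Proof.
move=> k x; case: k => [|k]; first exact: derivable_id.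
suff [a ->] : exists a : R, derive1n k.+1 (@id R) = cst a by exact: derivable_cst.
elim: k => [|k [a IH]].
  exists 1; rewrite derive1n1; apply/funext => y.
  by rewrite derive1E derive_id.
by exists 0; rewrite derive1nS IH; apply/funext => y; rewrite derive1_cst.
Qed.

Lemma flow_domain_smooth : smooth_on (product_structure F (@Cinf_line R)) F
  [set p | reach p.1 p.2] Phi.
Proof.
move=> f Ff.
pose Y (p : [set p : M * R | reach p.1 p.2]) : 'rV[R]_(n + 1) :=
  row_mx (X (val p).1) (const_mx (val p).2).
apply: (@diff_structure_local R (n + 1) _ _ Y).
- exact: generated_diff_structure.
- move=> k; have -> : (fun q => Y q 0 k) = (fun q =>
      match fintype.split k with inl j => X (val q).1 0 j | inr _ => (val q).2 end).
    by apply/funext => q; rewrite mxE; case: (fintype.split k) => j; rewrite ?mxE.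
  case: (fintype.split k) => j.
    apply: sub_generated; exists (fun p : M * R => X p.1 0 j) => //.
    by apply: sub_generated; left; exists (fun q => X q 0 j).
  apply: sub_generated; exists (fun p : M * R => p.2) => //; apply: sub_generated; right.
  by exists id => //; exact: Cinf_line_id.
- move=> p; have [d [h [d0 Ch hP]]] := flow_function_smooth Ff (set_valP p).
  exists d, h; split=> // q /row_mx_near[qd td].
  by rewrite /= -(hP _ _ qd td (set_valP q)) -surjective_pairing.
Qed.

Lemma flow_curve_smooth x :
  smooth_on (@Cinf_line R) F (reach x) (fun t => Phi (x, t)).
Proof.
move=> f Ff; pose Y (t : reach x) : 'rV[R]_1 := const_mx (val t).
apply: (@diff_structure_local R 1 _ _ Y).
- exact: generated_diff_structure.
- move=> k; have -> : (fun q => Y q 0 k) = val by apply/funext => q; rewrite mxE.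
  by apply: sub_generated; exists id => //; exact: Cinf_line_id.
- move=> p; have [d [h [d0 Ch hP]]] := flow_function_smooth Ff (set_valP p).
  exists d, (fun y => h (row_mx (X x) y)); split=> // [|q qd].
    apply: Cinf_comp => // k; under eq_fun do rewrite mxE.
    by case: (fintype.split k) => j; [exact: Cinf_cst|exact: Cinf_coord].
  rewrite /= -hP//.
  + by rewrite subrr normr0.
  + by have := norm_coord_le (Y q - Y p) 0; rewrite !mxE => /le_lt_trans; apply.
  + exact: (set_valP q).
Qed.

(* A union of intervals containing [0] is near [t], on each side of [t], a single
   one of them, but the two sides may need different ones. *)
Lemma flow_one_sided_derivative f x t w0 : F f -> reach x t -> reach x w0 -> w0 != t ->
  forall e, 0 < e -> exists2 d, 0 < d & forall w, reach x w ->
    0 <= (w - t) * (w0 - t) -> `|w - t| < d ->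
    `|f (Phi (x, w)) - f (Phi (x, t)) - v f (Phi (x, t)) * (w - t)| <= e * `|w - t|.
Proof.
move=> Ff Wt Ww0 w0t e e0.
(* If moving from [t] towards [w0] leads away from 0, the curve reaching [w0] passes through [t].
   Otherwise 0 lies on the side of [w0], and any curve reaching [t] covers that side. *)
have [J [c [b [[cJ c0 Jt Jb] side]]]] : exists (J : set R) (c : R -> M) (b : R),
    [/\ integral_curve F v J c, c 0 = x, J t & J b] /\ 0 < (b - t) * (w0 - t).
  have w0t2 : 0 < (w0 - t) * (w0 - t).
    by rewrite -expr2 exprn_even_gt0//= subr_eq0.
  have [J [c [cJ c0 Jt]]] := Wt; have [_ J0 _] := cJ.
  have [J' [c' [cJ' c'0 J'w0]]] := Ww0; have [_ J'0 _] := cJ'.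
  have [tw0|/ltW w0_t] := leP t w0.
    have [t0|t0] := leP 0 t.
      exists J', c', w0; split=> //; split=> //.
      by apply: (integral_curve_interval cJ' J'0 J'w0); rewrite t0.
    exists J, c, 0; split=> //; rewrite sub0r mulr_gt0 ?oppr_gt0//.
    by rewrite subr_gt0 lt_def w0t.
  have [t0|t0] := leP t 0.
    exists J', c', w0; split=> //; split=> //.
    by apply: (integral_curve_interval cJ' J'w0 J'0); rewrite w0_t.
  exists J, c, 0; split=> //; rewrite sub0r nmulr_lgt0 ?oppr_lt0//.
  by rewrite subr_lt0 lt_def eq_sym w0t.
have bt : b != t.
  by apply/eqP => bt; move: side; rewrite bt subrr mul0r ltxx.
have dJ : has_derivative_within J (f \o c) t (v f (c t)).
  have [_ _ [[u JE]|[_ H]]] := cJ; last exact: H.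
  by move: Jt Jb bt; rewrite JE => /= -> ->; rewrite eqxx.
have [d d0 dP] := (derivative_withinP _ _ _ _).1 dJ e e0.
(* Closer to [t] than [b], and on its side, [w] lies between [t] and [b], hence in [J]. *)
exists (Num.min d `|b - t|) => [|w Ww wside].
  by rewrite lt_min d0 normr_gt0 subr_eq0.
rewrite lt_min => /andP[wd wb].
have Jw : J w.
  have iJ := integral_curve_interval cJ.
  have [tb|bt'] := ltP t b.
    apply: (iJ t b) => //; move: wb; rewrite (gtr0_norm (x := b - t)) ?subr_gt0//.
    rewrite ltr_norml => /andP[w1 w2]; apply/andP; split; last by lra.
    rewrite -subr_ge0; have w0p : 0 < w0 - t by move: side; rewrite pmulr_rgt0// subr_gt0.
    by move: wside; rewrite pmulr_lge0.
  have {}bt' : b < t by rewrite lt_def eq_sym bt.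
  apply: (iJ b t) => //; move: wb; rewrite (ltr0_norm (x := b - t)) ?subr_lt0//.
  rewrite ltr_norml => /andP[w1 w2]; apply/andP; split; first by lra.
  rewrite -subr_le0; have w0n : w0 - t < 0 by move: side; rewrite nmulr_rgt0// subr_lt0.
  by move: wside; rewrite nmulr_lge0.
by rewrite -c0 (PhiP cJ Jt) (PhiP cJ Jw); exact: dP.
Qed.

Lemma flow_derivative f x t : F f -> reach x t ->
  has_derivative_within (reach x) (f \o (fun t => Phi (x, t))) t (v f (Phi (x, t))).
Proof.
move=> Ff Wt; apply/derivative_withinP => e e0 /=.
(* The signs [s = 1] and [s = -1] select the two sides of [t]. On a side without points of [reach x]
   only [w = t] remains, where both members of the inequality vanish. *)
have side (s : R) : exists2 d, 0 < d & forall w, reach x w -> 0 <= (w - t) * s ->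
    s != 0 -> `|w - t| < d ->
    `|f (Phi (x, w)) - f (Phi (x, t)) - v f (Phi (x, t)) * (w - t)| <= e * `|w - t|.
  have [[w0 [Ww0 ws]]|nw0] := pselect (exists w0, reach x w0 /\ 0 < (w0 - t) * s).
    have w0t : w0 != t by apply/eqP => E; move: ws; rewrite E subrr mul0r ltxx.
    have [d d0 dP] := flow_one_sided_derivative Ff Wt Ww0 w0t e0.
    exists d => // w Ww wss s0; apply: dP => //.
    have s2 : 0 < s ^+ 2 by rewrite exprn_even_gt0.
    rewrite -(pmulr_lge0 _ s2) (_ : _ * s ^+ 2 = ((w - t) * s) * ((w0 - t) * s)).
      by rewrite mulr_ge0// ltW.
    by ring.
  exists 1 => // w Ww wss s0 _.
  suff -> : w = t by rewrite !subrr mulr0 subrr normr0 mulr0.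
  apply/eqP; rewrite -subr_eq0; apply/eqP; move: wss; rewrite le_eqVlt => /orP[|ws].
    by rewrite eq_sym mulf_eq0 (negbTE s0) orbF => /eqP.
  by exfalso; apply: nw0; exists w.
have [d1 d10 d1P] := side 1; have [d2 d20 d2P] := side (-1).
exists (Num.min d1 d2) => [|w Ww]; first by rewrite lt_min d10.
rewrite lt_min => /andP[w1 w2]; have [tw|wt] := leP t w.
  by apply: d1P; rewrite ?mulr1 ?subr_ge0 ?oner_eq0.
apply: d2P; rewrite ?oppr_eq0 ?oner_eq0//.
by rewrite mulrN1 oppr_ge0 subr_le0 ltW.
Qed.

Lemma flow_integral_curve x : integral_curve F v (reach x) (fun t => Phi (x, t)).
Proof.
split; [exact/connected_intervalP/reach_interval|exact: reach0|right].
by split=> [|f Ff t Wt]; [exact: flow_curve_smooth|exact: flow_derivative].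
Qed.

Lemma flow_domain_flow : flow F v [set p | reach p.1 p.2] Phi.
Proof.
split.
- exact: flow_domain_smooth.
- by move=> x; exact: reach0.
- exact: Phi0.
- by move=> x; apply/connected_intervalP; exact: reach_interval.
- move=> x; split; first exact: flow_integral_curve.
  move=> K tau ctau; rewrite /= Phi0 => tau0; split=> t Kt; first by exists K, tau.
  by rewrite -tau0 (PhiP ctau Kt).
Qed.

End Flow.

(** The curves of either flow are integral curves with the same origin, so each is contained in the
    other by maximality. *)
Lemma flow_unique (R : realType) (M : Type) (F : set (M -> R))
    (v : (M -> R) -> (M -> R)) (W W' : set (M * R)) (Phi Phi' : M * R -> M) :
  flow F v W Phi -> flow F v W' Phi' ->
  W' = W /\ forall p, W p -> Phi' p = Phi p.
Proof.
move=> fW fW'.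
have max x := flow_maximal fW x; have max' x := flow_maximal fW' x.
have E x : Phi (x, 0) = Phi' (x, 0) by rewrite (flow_init fW) (flow_init fW').
split=> [|[x t] Wxt].
  apply/seteqP; split=> -[x t] Wxt.
    by have [sub _] := (max x).2 _ _ (max' x).1 (esym (E x)); exact: (sub t).
  by have [sub _] := (max' x).2 _ _ (max x).1 (E x); exact: (sub t).
by have [_ eqP] := (max' x).2 _ _ (max x).1 (E x); exact: (eqP t).
Qed.

Theorem theorem3p14 (R : realType) (M : topologicalType) (F : set (M -> R))
    (v : (M -> R) -> (M -> R)) :
  diff_space F ->
  (exists (n : nat) (S : set 'rV[R]_n),
     diffeomorphic F (subspace_structure (@Cinf R n) (S := S))) ->
  derivation F v ->
  exists (W : set (M * R)) (Phi : M * R -> M),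
    flow F v W Phi /\
    forall (W' : set (M * R)) (Phi' : M * R -> M),
      flow F v W' Phi' ->
      W' = W /\ forall p, W p -> Phi' p = Phi p.
Proof.
move=> _ [n [S /diffeomorphic_coordinates[X [Xinj FX Floc]]]] dv.
have vF := der_stable dv.
have [Phi PhiP] := flow_map_exists Xinj FX Floc vF.
have fPhi := flow_domain_flow FX Floc vF PhiP.
by exists [set p | reach F v p.1 p.2], Phi; split=> // W' Phi'; exact: flow_unique.
Qed.
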